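(* Let $\kappa$ be an infinite cardinal. Assume $\mathrm{I}^-(\kappa)$, and assume that either $\Diamond_\kappa$ holds or $\kappa$ is inaccessible. Let $X$ be an analytic subset of the $\kappa$-Baire space ${}^\kappa\kappa$, let $1\le n<\omega$, and let $R$ be an $n$-ary $F_\sigma$ relation on $X$. Then either every $R$-independent subset of $X$ has cardinality $\le\kappa$, or there exists a perfect $R$-independent subset of $X$.
   Context: The $\kappa$-Baire space is the set ${}^\kappa\kappa$ of functions $\kappa\to\kappa$ with the topology generated by the sets $N_p=\{x\in{}^\kappa\kappa: p\subseteq x\}$ for $p\in{}^{<\kappa}\kappa$; finite powers carry the product topology. A subset of a topological space is $F_\sigma$ if it is a union of at most $\kappa$ closed sets, and $G_\delta$ if it is an intersection of at most $\kappa$ open sets. A set $X\subseteq{}^\kappa\kappa$ is analytic if it is the image of a closed subset of ${}^\kappa\kappa$ under a continuous map ${}^\kappa\kappa\to{}^\kappa\kappa$. An $n$-ary relation on $X$ (with the subspace topology) is a subset $R\subseteq{}^nX$; it is $F_\sigma$ if it is $F_\sigma$ in the product topology on ${}^nX$. A set $Y\subseteq X$ is $R$-independent if $(y_0,\dots,y_{n-1})\notin R$ for all pairwise distinct $y_0,\dots,y_{n-1}\in Y$. A tree $T\subseteq{}^{<\kappa}\kappa$ (closed under initial segments) is perfect if every node of $T$ has an extension in $T$ with at least two immediate successors in $T$, and every increasing sequence of elements of $T$ of length $<\kappa$ has an upper bound in $T$; a set $Y\subseteq{}^\kappa\kappa$ is perfect if $Y=[T]=\{x\in{}^\kappa\kappa: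 x\restriction\alpha\in T \text{ for all }\alpha<\kappa\}$ for some perfect tree $T$. $\mathrm{I}^-(\kappa)$ is the hypothesis: there is a $\kappa^+$-complete normal non-principal ideal $\mathcal I$ on $\kappa^+$ such that $\mathcal I^+=\mathcal P(\kappa^+)\setminus\mathcal I$ has a dense subset $K$ (every element of $\mathcal I^+$ contains an element of $K$) in which every $\subseteq$-descending sequence of length $<\kappa$ has a lower bound in $K$. *)

(* Defs.v *)
From HB Require Import structures.
From mathcomp Require Import all_boot all_order.
From mathcomp Require Import all_classical topology.
From mathcomp Require Import wochoice.

Set Implicit Arguments.
Unset Strict Implicit.
Unset Printing Implicit Defensive.

Local Open Scope classical_set_scope.
Local Open Scope card_scope.
Local Open Scope order_scope.

(* An infinite cardinal kappa is a well-ordered type K none of whose proper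
   initial segments has the cardinality of K.  An ordinal alpha < kappa is an
   element a of K, identified with the set [below a] of its predecessors;
   hence "sequence of length < kappa" means a function on [below a], a : K,
   which includes the empty sequence. *)
Definition below d (K : orderType d) (a : K) : set K := [set b | b < a].

Definition infinite_cardinal d (K : orderType d) : Prop :=
  [/\ well_order (<=%O : rel K),
      forall a : K, ~ ([set: K] #<= below a) &
      infinite_set [set: K]].

(* S has the order type of kappa^+, the least ordinal of cardinality > kappa *)
Definition successor_cardinal d (K : orderType d) e (S : orderType e) : Prop :=
  [/\ well_order (<=%O : rel S),
      ~ ([set: S] #<= [set: K]) &
      forall a : S, below a #<= [set: K]].

Definition regular d (K : orderType d) : Prop :=
  forall (a : K) (f : below a -> K), exists c : K, forall b, f b < c.

Definition strong_limit d (K : orderType d) : Prop :=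
  forall a : K, ~ ([set: K] #<= [set B : set K | B `<=` below a]).

Definition inaccessible d (K : orderType d) : Prop :=
  [/\ ~ countable [set: K], regular K & strong_limit K].

(* A nonzero a in which C is cofinal is automatically a limit ordinal. *)
Definition club d (K : orderType d) (C : set K) : Prop :=
  (forall a : K, exists2 c, C c & a < c) /\
  (forall a : K, below a !=set0 ->
     (forall b, b < a -> exists2 c, C c & b < c < a) -> C a).

Definition stationary d (K : orderType d) (A : set K) : Prop :=
  forall C : set K, club C -> A `&` C !=set0.

Definition diamond d (K : orderType d) : Prop :=
  exists A : K -> set K,
    (forall a, A a `<=` below a) /\
    (forall B : set K, stationary [set a | B `&` below a = A a]).

Section Ideals.
Context d (S : orderType d).
Implicit Types I : set (set S).

Definition ideal I : Prop :=
  [/\ I set0,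
      ~ I setT,
      forall A B, A `<=` B -> I B -> I A &
      forall A B, I A -> I B -> I (A `|` B)].

(* S-completeness: closure under unions of fewer than |S| members *)
Definition complete_ideal I : Prop :=
  forall F : set (set S), F `<=` I -> ~ ([set: S] #<= F) ->
    I (\bigcup_(A in F) A).

(* closure under diagonal unions *)
Definition normal_ideal I : Prop :=
  forall A : S -> set S, (forall a, I (A a)) ->
    I [set x | exists2 a, a < x & A a x].

Definition principal_ideal I : Prop := exists A : set S, I = [set B | B `<=` A].

Definition dense_in (D P : set (set S)) : Prop :=
  D `<=` P /\ forall A, P A -> exists2 B, D B & B `<=` A.

End Ideals.

(* every descending sequence of length < kappa in D has a lower bound in D *)
Definition descending_closed d (K : orderType d) T (D : set (set T)) : Prop :=
  forall (a : K) (s : below a -> set T),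
    (forall b, D (s b)) ->
    (forall b c : below a, \val b <= \val c -> s c `<=` s b) ->
    exists2 L, D L & forall b, L `<=` s b.

Definition I_minus d (K : orderType d) : Prop :=
  exists (e : Order.disp_t) (S : orderType e) (I : set (set S)),
    successor_cardinal K S /\
    [/\ ideal I, complete_ideal I, normal_ideal I & ~ principal_ideal I] /\
    exists2 D : set (set S), dense_in D (~` I) & descending_closed K D.

Section Baire.
Context d (K : orderType d).

(* The alias keeps [K -> K] from receiving the topology of pointwise
   convergence. *)
Definition baire : Type := K -> K.

Definition short_seq : Type := {a : K & below a -> K}.
Definition len (p : short_seq) : K := projT1 p.
Definition entry (p : short_seq) : below (len p) -> K := projT2 p.

Definition restr (x : baire) (a : K) : short_seq :=
  existT (fun a => below a -> K) a (fun b => x (\val b)).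

Definition cone (p : short_seq) : set baire :=
  [set x | forall b : below (len p), x (\val b) = entry b].

HB.instance Definition _ := Choice.copy baire (K -> K).
HB.instance Definition _ := @isSubBaseTopological.Build baire
  (set baire) (range cone) id.

(* inclusion of graphs *)
Definition initial_seg (p q : short_seq) : Prop :=
  forall b : below (len p),
    exists2 c : below (len q), \val c = \val b & entry c = entry b.

(* q extends p and len q = len p + 1 *)
Definition imm_succ (p q : short_seq) : Prop :=
  initial_seg p q /\ forall c : K, (c < len q) = (c <= len p).

Definition tree (T : set short_seq) : Prop :=
  forall p q, initial_seg p q -> T q -> T p.

(* In the last clause the empty sequence is allowed, so that a perfect tree is
   nonempty. *)
Definition perfect_tree (T : set short_seq) : Prop :=
  [/\ tree T,
      forall p, T p -> exists q, [/\ T q, initial_seg p q &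
        exists r1 r2, [/\ T r1, T r2, imm_succ q r1, imm_succ q r2 & r1 <> r2]] &
      forall (a : K) (s : below a -> short_seq),
        (forall b, T (s b)) ->
        (forall b c : below a, \val b <= \val c -> initial_seg (s b) (s c)) ->
        exists2 q, T q & forall b, initial_seg (s b) q].

Definition branches (T : set short_seq) : set baire :=
  [set x | forall a, T (restr x a)].

Definition perfect (Y : set baire) : Prop :=
  exists2 T, perfect_tree T & Y = branches T.

Definition analytic (X : set baire) : Prop :=
  exists (C : set baire) (f : baire -> baire),
    [/\ closed C, continuous f & X = f @` C].

(* union of at most kappa closed sets *)
Definition kappa_Fsigma (T : topologicalType) (A : set T) : Prop :=
  exists F : set (set T),
    [/\ F #<= [set: K], F `<=` closed & A = \bigcup_(C in F) C].

End Baire.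

(* finite power with the product topology *)
Definition power (n : nat) (T : topologicalType) : topologicalType :=
  prod_topology (fun _ : 'I_n => T).

Definition independent n (T : topologicalType) (R : set (power n T))
    (Y : set T) : Prop :=
  forall y : 'I_n -> T, injective y -> (forall i, Y (y i)) -> ~ R y.

(* Main.v *)
(** Fix an independent set of size kappa^+ and read the ideal as a family of
    conditions: a condition is a positive set of indices of points of the set,
    and the dense subset of positive sets is closed under descending sequences
    of length < kappa.  Since kappa^(<kappa) = kappa, almost all points p of a
    condition are condensation points: each neighbourhood of p meets the
    condition in a positive set.  Hence a condition can be split into two
    conditions whose points differ at a given coordinate, and pairwise disjoint
    conditions B_1, ..., B_n can be shrunk so as to be surrounded by
    neighbourhoods whose product misses a given closed part of R.  This yields a
    tree of conditions indexed by the bounded 0-1 sequences whose branches form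
    a perfect set.  At stage a only fewer than kappa many n-tuples of nodes can
    be treated: all of them if kappa is inaccessible, the ones guessed by the
    diamond sequence otherwise; either way every n-tuple of branches is treated
    for each of the kappa closed parts of R. *)

Require Import Defs.
From HB Require Import structures.
From mathcomp Require Import all_boot all_order finmap.
From mathcomp Require Import all_classical topology.
From mathcomp Require Import wochoice.

Set Implicit Arguments.
Unset Strict Implicit.
Unset Printing Implicit Defensive.

Import Order.TTheory.

Local Open Scope order_scope.
Local Open Scope card_scope.
Local Open Scope classical_set_scope.

(** * Well-orders and cardinals *)

Lemma card_leTP T U :
  [set: T] #<= [set: U] <-> exists f : T -> U, injective f.
Proof.
split=> [/card_leP[f]|[f finj]].
  exists (fun x => \val (f (SigSub (mem_set (I : [set: T] x))))) => x y.
  have fI := inj (f := f).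
  by move=> /val_inj /fI; rewrite !inE => /(_ I I) /(congr1 val).
have fi : set_inj [set: T] f by move=> x y _ _ /finj.
have /injfunPex[g] : exists2 f : T -> U, set_fun [set: T] [set: U] f & set_inj [set: T] f.
  by exists f.
exact: inj_card_le g.
Qed.

Lemma card_le_setP T U (A : set T) (B : set U) :
  A #<= B <-> exists f : A -> B, injective f.
Proof.
by rewrite -card_leTP (card_le_eql (card_setT A)) (card_le_eqr (card_setT B)).
Qed.

Lemma card_le_belowP T d (W : orderType d) (c : W) :
  [set: T] #<= below c <-> exists2 f : T -> W, injective f & forall t, f t < c.
Proof.
split=> [/card_le_setP[f finj]|[f finj fc]].
  exists (fun t => \val (f (SigSub (mem_set (I : [set: T] t))))).
    by move=> x y /val_inj /finj /(congr1 val).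
  by move=> t; exact: set_mem (valP (f _)).
apply/card_le_setP.
exists (fun t => SigSub (mem_set (fc (\val t) : below c _))) => x y.
by move=> /(congr1 val) /= /finj /val_inj.
Qed.

Section WellOrder.
Context d (W : orderType d) (Wwo : well_order (<=%O : rel W)).

Lemma wo_min (A : set W) : A !=set0 -> exists2 m, A m & forall b, A b -> m <= b.
Proof.
move=> [a Aa]; have [|m [[Am mlb] _]] := Wwo (A := [pred x | x \in A]).
  by exists a; rewrite !inE.
by exists m => [|b Ab]; [move: Am; rewrite !inE|apply: mlb; rewrite !inE].
Qed.

Lemma wo_ind (P : W -> Prop) :
  (forall a, (forall b, b < a -> P b) -> P a) -> forall a, P a.
Proof.
move=> IH a; apply: contrapT => Pa.
have [|m nPm mlb] := @wo_min (~` P); first by exists a.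
by apply: nPm; apply: IH => b bm; apply: contrapT => /mlb; rewrite leNgt bm.
Qed.

Lemma wo_wf : well_founded (fun a b : W => a < b).
Proof. by apply: wo_ind => a IH; constructor. Qed.

(** Recursion along [W] in which each value is picked among those that [Q] allows given the earlier
    ones. A correct value is available only after correct earlier choices, so [H] chooses
    conditionally and correctness is recovered by induction. *)
Lemma wo_choice (T : Type) (t0 : T) (Q : W -> (W -> T) -> T -> Prop) :
  (forall a f g v, (forall b, b < a -> f b = g b) -> Q a f v -> Q a g v) ->
  (forall a f, (forall b, b < a -> Q b f (f b)) -> exists v, Q a f v) ->
  exists F, forall a, Q a F (F a).
Proof.
move=> Qext Qex.
have [H HQ] : {H : W * (W -> T) -> T & forall p,
    (forall b, b < p.1 -> Q b p.2 (p.2 b)) -> Q p.1 p.2 (H p)}.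
  apply: (@choice _ _ (fun p v =>
    (forall b, b < p.1 -> Q b p.2 (p.2 b)) -> Q p.1 p.2 v)) => -[a f] /=.
  have [h|nh] := pselect (forall b, b < a -> Q b f (f b)).
    by have [v Qv] := Qex a f h; exists v.
  by exists t0 => /nh.
(* The filler [t0] outside the segment is harmless, since [Q] does not look there. *)
pose ext (a : W) (g : forall b : W, b < a -> T) (b : W) : T :=
  if pselect (b < a) is left ba then g b ba else t0.
pose F := Fix wo_wf (fun=> T) (fun a g => H (a, ext a g)).
have FE a : F a = H (a, ext a (fun b _ => F b)).
  rewrite /F Fix_eq // => x f g fg; congr (H (_, _)).
  by apply/funext => b; rewrite /ext; case: pselect.
exists F; elim/wo_ind => a IH.
have extE b : b < a -> ext a (fun b _ => F b) b = F b.
  by rewrite /ext; case: pselect.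
rewrite FE; apply: (Qext a (ext a (fun b _ => F b))) => //.
apply: (HQ (a, _)) => b ba /=; rewrite extE//.
apply: Qext (IH b ba) => c cb; rewrite extE//; exact: lt_trans ba.
Qed.

(** Picking a new value in [T] at each point of [W] either never gets stuck, which embeds [W] in
    [T], or gets stuck at some [a], and then the values picked below [a] exhaust [T]. *)
Lemma card_trichotomy (T : Type) :
  ~ ([set: W] #<= [set: T]) -> exists c : W, [set: T] #<= below c.
Proof.
move=> WT; apply: contrapT => nc; apply: WT; apply/card_leTP.
have [[t0 _]|nT] := pselect (exists t : T, True); last first.
  have [[w _]|nW] := pselect (exists w : W, True).
    exfalso; apply: nc; exists w; apply/card_le_belowP.
    by exists (fun=> w) => t; exfalso; apply: nT; exists t.
  have f (w : W) : T by exfalso; apply: nW; exists w.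
  by exists f => w; exfalso; apply: nW; exists w.
have [|a f _|F FQ] := @wo_choice T t0 (fun a f v => forall b, b < a -> f b <> v).
- by move=> a f g v fg fv b ba; rewrite -fg//; exact: fv.
- apply: contrapT => nv; apply: nc; exists a; apply/card_le_belowP.
  have [g gP] : {g : T -> W & forall v, g v < a /\ f (g v) = v}.
    apply: (@choice _ _ (fun v b => b < a /\ f b = v)) => v; apply: contrapT => h.
    by apply: nv; exists v => b ba fb; apply: h; exists b.
  exists g; last by move=> t; have [] := gP t.
  by move=> s t gst; rewrite -(gP s).2 -(gP t).2 gst.
- exists F => a b Fab; case: (ltgtP a b) => // h.
  + by case: (FQ b a h).
  + by case: (FQ a b h).
Qed.

End WellOrder.

Section Cardinal.
Context d (K : orderType d) (Kcard : infinite_cardinal K).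

Let Kwo : well_order (<=%O : rel K). Proof. by case: Kcard. Qed.

Lemma cardinal_nat : exists h : nat -> K, injective h.
Proof. by apply/card_leTP/infiniteP; case: Kcard. Qed.

(** A greatest element could be absorbed into the segment below it by shifting a countable sequence,
    so that [K] would embed in a proper initial segment. *)
Lemma cardinal_nomax (a : K) : exists b, a < b.
Proof.
apply: contrapT => na.
have amax b : b <= a by rewrite leNgt; apply/negP => ab; apply: na; exists b.
have [_ Kinit _] := Kcard; apply: (Kinit a); apply/card_le_belowP.
have [h hinj] := cardinal_nat.
(* The sequence has to avoid [a], so the terms of [h] up to a possible occurrence of [a] are
   dropped. *)
have [g ginj ga] : exists2 g : nat -> K, injective g & forall n, g n < a.
  have [[n hn]|nh] := pselect (exists n, h n = a).
    exists (fun k => h (n.+1 + k)%N) => [k l /hinj /addnI //|k].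
    rewrite lt_neqAle amax andbT; apply/eqP; rewrite -hn => /hinj /eqP.
    by rewrite addSnnS -[X in _ == X]addn0 eqn_add2l.
  exists h => // k; rewrite lt_neqAle amax andbT; apply/eqP => hk.
  by apply: nh; exists k.
pose f b := if b == a then g 0%N else
  if pselect (exists k, g k = b) is left e then g (sval (cid e)).+1 else b.
exists f => [x y|t]; last first.
  rewrite /f; case: eqP => [//|/eqP ta]; case: pselect => // _.
  by rewrite lt_neqAle ta amax.
rewrite /f; case: eqP => [->|xa]; case: eqP => [->//|ya].
- case: pselect => [e /ginj//|ne gy]; by case: ne; exists 0%N.
- case: pselect => [e /ginj//|ne gy]; by case: ne; exists 0%N.
- case: pselect => [e|ne]; case: pselect => [e'|ne'] //.
  + by move=> /ginj [ee']; rewrite -(svalP (cid e)) -(svalP (cid e')) /= ee'.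
  + by move=> gy; case: ne'; eexists; exact: gy.
  + by move=> gy; case: ne; eexists; symmetry; exact: gy.
Qed.

Lemma cardinal_ub2 (a b : K) : exists2 c, a < c & b < c.
Proof.
have [c] := cardinal_nomax (Order.max a b).
by rewrite gt_max => /andP[]; exists c.
Qed.

Lemma cardinal_ub_fin n (f : 'I_n -> K) : exists c, forall i, f i < c.
Proof.
elim: n f => [|n IH] f.
  by have [h _] := cardinal_nat; exists (h 0%N) => -[].
have [c1 h1] := IH (fun i => f (lift ord0 i)).
have [c h2 h3] := cardinal_ub2 c1 (f ord0).
exists c => i; case: (unliftP ord0 i) => [j|] -> //.
exact: lt_trans (h1 j) h2.
Qed.

Lemma regular_ub : regular K -> forall T (a : K) (g f : T -> K),
  injective g -> (forall t, g t < a) -> exists c, forall t, f t < c.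
Proof.
move=> Kreg T a g f ginj ga.
have [[t0 _]|nT] := pselect (exists t : T, True); last first.
  by exists a => t; exfalso; apply: nT; exists t.
have [c cP] := Kreg a (fun b => if pselect (exists t, g t = \val b) is left e
  then f (sval (cid e)) else a).
exists c => t; have := cP (SigSub (mem_set (ga t : below a _))).
case: pselect => [e|ne] /=; first by rewrite (ginj _ _ (svalP (cid e))).
by case: ne; exists t.
Qed.

End Cardinal.

(** * Guessing and coding *)

Section Guessing.
Context d (K : orderType d) (Kcard : infinite_cardinal K).

Let Kwo : well_order (<=%O : rel K). Proof. by case: Kcard. Qed.

Lemma club_above (a : K) : club [set c | a < c].
Proof.
split=> [b|b [c cb] h]; first by have [c] := cardinal_ub2 Kcard a b; exists c.
by have [c' ac' /andP[_ c'b]] := h c cb; exact: lt_trans c'b.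
Qed.

(* The club of closure points of the function sending [c] to the first value
   of [F] above [c]; distinct closure points yield distinct first indices. *)
Lemma cofinal_club e (J : orderType e) (P : set J) (F : J -> K) (a : K) :
    well_order (<=%O : rel J) -> (forall c, exists2 j, P j & c < F j) ->
  exists (next : K -> J) (C : set K), [/\ club C, forall c, P (next c),
    forall c, C c -> a < c &
    forall c c', C c -> C c' -> c < c' -> next c < next c'].
Proof.
move=> Jwo Fcof.
have [next nextP] : {next : K -> J & forall c, [/\ P (next c), c < F (next c) &
    forall j, P j -> c < F j -> next c <= j]}.
  apply: (@choice _ _ (fun c k => [/\ P k, c < F k & forall j, P j -> c < F j -> k <= j])) => c.
  have [|m [Pm cm] mlb] := @wo_min _ _ Jwo [set j | P j /\ c < F j].
    by have [j Pj cj] := Fcof c; exists j.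
  by exists m; split=> // j Pj cj; exact: mlb.
pose C := [set c | a < c /\ forall b, b < c -> F (next b) <= c].
exists next, C; split.
- split=> [b|b [b0 b0b] h].
    have [b' ab' bb'] := cardinal_ub2 Kcard a b.
    have [_ b'n nmin] := nextP b'.
    (* This value is a closure point: for [c] below it [next c <= next b'], and a larger value of
       [F] at [next c] would exceed [b'], so minimality of [next b'] would force
       [next c = next b']. *)
    exists (F (next b')); last exact: lt_trans b'n.
    split=> [|c cF]; first exact: lt_trans b'n.
    rewrite leNgt; apply/negP => Fc.
    have [Pc _ cmin] := nextP c.
    have : next c <= next b' by apply: cmin => //; have [] := nextP b'.
    have b'c : b' < F (next c) by exact: lt_trans Fc.
    by rewrite le_eqVlt => /orP[/eqP nn|]; [rewrite nn ltxx in Fc|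
       rewrite ltNge nmin].
  split; first by have [c [ac _] /andP[_ cb]] := h b0 b0b; exact: lt_trans cb.
  move=> c cb; have [c' [_ c'C] /andP[cc' c'b]] := h c cb.
  exact: le_trans (c'C _ cc') (ltW c'b).
- by move=> c; have [] := nextP c.
- by move=> c [].
- move=> c c' [_ Cc] [_ Cc'] cc'.
  have [_ _ cmin] := nextP c; have [Pn' c'n _] := nextP c'.
  rewrite lt_neqAle cmin ?andbT//; last exact: lt_trans c'n.
  by apply/eqP => nn; have := Cc' c cc'; rewrite nn leNgt c'n.
Qed.

(** A cofinal map on [below a] gives a club on which the indices [next c] are distinct and below
    [a], hence below [c]. One set [B] can then differ from each [A c] at the point [next c], so no
    [c] in the club guesses [B]. *)
Lemma diamond_regular : diamond K -> regular K.
Proof.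
move=> [A [Asub Ast]] a f; apply: contrapT => nub.
pose F j := if pselect (j < a) is left ja then f (SigSub (mem_set (ja : below a j))) else a.
have [|next [C [Cclub Cnext Ca Cinj]]] := @cofinal_club _ _ (below a) F a Kwo.
  move=> c; have [c' cc'] := cardinal_nomax Kcard c; apply: contrapT => nj.
  apply: nub; exists c' => b; rewrite ltNge; apply/negP => c'f.
  apply: nj; exists (\val b); first exact: set_mem (valP b).
  apply: lt_le_trans cc' _; rewrite /F; case: pselect => [ja|]; last first.
    by case; exact: set_mem (valP b).
  by rewrite (_ : SigSub _ = b)//; exact: val_inj.
pose B := [set i | i < a /\ forall c, C c -> next c = i -> ~ A c i].
have [c [Bc Cc]] := Ast B _ Cclub; have {}Bc : B `&` below c = A c := Bc.
have na := Cnext c; have nc : next c < c by exact: lt_trans (Ca c Cc).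
have [Ai|nAi] := pselect (A c (next c)).
  have := Ai; rewrite -Bc => -[[_ h] _]; exact: h Ai.
have : (B `&` below c) (next c); last by rewrite Bc.
split=> //; split=> // c' Cc' nn; case: (ltgtP c c') => [h|h|<- //].
- by have := Cinj _ _ Cc Cc' h; rewrite nn ltxx.
- by have := Cinj _ _ Cc' Cc h; rewrite nn ltxx.
Qed.

Lemma nat_well_order : well_order (<=%O : rel nat).
Proof.
apply: antisymmetric_well_order; first exact: le_anti.
move=> A [n An].
have ex : exists n, n \in A by exists n.
by case: (ex_minnP ex) => m Am mlb; exists m; split.
Qed.

(** A cofinal sequence yields a club of order type omega, whose unbounded subsets have no limit
    points and are therefore clubs. If [k0] lies in [A c] for unboundedly many [c] of the club, then
    the empty set is not guessed there; otherwise the singleton of [k0] is not guessed on a final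
    part. *)
Lemma diamond_nat_ub : diamond K -> forall h : nat -> K, exists c, forall n, h n < c.
Proof.
move=> [A [Asub Ast]] h; apply: contrapT => nub.
have [k0 _] := cardinal_nat Kcard; move: (k0 0%N) => {}k0.
have [|next [C [Cclub _ Ca Cinj]]] :=
    @cofinal_club _ _ setT h k0 nat_well_order.
  move=> c; have [c' cc'] := cardinal_nomax Kcard c; apply: contrapT => nj.
  apply: nub; exists c' => n; rewrite ltNge; apply/negP => c'f.
  by apply: nj; exists n => //; exact: lt_le_trans c'f.
(* below any point there are only finitely many members of C *)
have subclub C' : C' `<=` C -> (forall a, exists2 c, C' c & a < c) -> club C'.
  move=> C'C C'unb; split=> // b [b0 b0b] lim.
  have Cb : C b.
    by apply: (Cclub.2) => [|b1 b1b]; [exists b0|have [c /C'C] := lim b1 b1b; exists c].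
  pose P n := `[< exists c, [/\ C' c, c < b & next c = n] >].
  have Pub n : P n -> (n <= next b)%N.
    move=> /asboolP[c [C'c cb <-]]; apply: ltnW.
    by have := Cinj _ _ (C'C _ C'c) Cb cb; rewrite ltEnat.
  have exP : exists n, P n.
    have [c C'c /andP[_ cb]] := lim b0 b0b.
    by exists (next c); apply/asboolP; exists c.
  case: (ex_maxnP exP Pub) => m /asboolP[c [C'c cb <-]] mmax.
  have [c' C'c' /andP[cc' c'b]] := lim c cb.
  have := mmax (next c'); rewrite leqNgt => /(_ _)/negP []; first by apply/asboolP; exists c'.
  by have := Cinj _ _ (C'C _ C'c) (C'C _ C'c') cc'; rewrite ltEnat.
have [unb|] := pselect (forall a, exists2 c, (C `&` [set c | A c k0]) c & a < c).
  have /Ast : club (C `&` [set c | A c k0]) by apply: subclub unb => c [].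
  move=> /(_ set0) [c [Ac [_]]]; have {}Ac : set0 `&` below c = A c := Ac.
  by rewrite /= -Ac => -[].
rewrite -existsNE => -[a na].
have /subclub : C `&` [set c | ~ A c k0] `<=` C by move=> c [].
case=> [b|unb lim].
  have [b' ab' bb'] := cardinal_ub2 Kcard a b.
  have [c Cc b'c] := Cclub.1 b'.
  exists c; last exact: lt_trans b'c.
  by split=> // Ack; apply: na; exists c => //; exact: lt_trans b'c.
have [c [Ac [Cc nA]]] := Ast [set k0] _ (conj unb lim).
have {}Ac : [set k0] `&` below c = A c := Ac.
apply: nA; rewrite -Ac; split=> //; exact: Ca.
Qed.

(** Fewer than kappa elements; the enumeration is allowed to take values outside [P]. *)
Definition small T (P : set T) : Prop :=
  exists (m : K) (e : K -> T), forall t, P t -> exists2 b, b < m & e b = t.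

(** The common consequence of the two alternatives: a diamond principle with fewer than kappa
    guesses at each stage. *)
Definition guessing : Prop := exists A : K -> set (set K),
  (forall a, small (A a)) /\
  (forall B, stationary [set a | A a (B `&` below a)]).

Lemma diamond_guessing : diamond K -> guessing.
Proof.
move=> [A [_ Ast]]; exists (fun a => [set A a]); split=> [a|B].
  have [b ab] := cardinal_nomax Kcard a.
  by exists b, (fun=> A a) => _ ->; exists a.
exact: Ast.
Qed.

Lemma strong_limit_powerset : strong_limit K -> forall a : K,
  exists (c : K) (g : set K -> K), (forall B, g B < c) /\
    forall B B', B `<=` below a -> B' `<=` below a -> g B = g B' -> B = B'.
Proof.
move=> Kstrong a; pose T := set_type [set B : set K | B `<=` below a].
have [|c /card_le_belowP[g ginj gc]] := @card_trichotomy _ _ Kwo T.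
  move=> h; apply: (Kstrong a); move: h.
  by rewrite (card_le_eqr (card_setT _)).
have T0 : set0 \in [set B : set K | B `<=` below a] by apply: mem_set => ?.
exists c, (fun B => if pselect (B `<=` below a) is left s then
  g (SigSub (mem_set (s : [set B : set K | B `<=` below a] B))) else g (SigSub T0)); split=> [B|B B' sB sB'].
  by case: pselect.
case: pselect => // sB1; case: pselect => // sB2 /ginj.
by move=> /(congr1 val).
Qed.

Lemma inaccessible_guessing : inaccessible K -> guessing.
Proof.
move=> [_ _ Kstrong]; exists (fun a => [set B | B `<=` below a]); split=> [a|B C [Cunb _]].
  have [c [g [gc ginj]]] := strong_limit_powerset Kstrong a.
  exists c, (fun b => if pselect (exists2 B, B `<=` below a & g B = b) is left e then
    sval (cid2 e) else set0) => B sB.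
  exists (g B) => //; case: pselect => [e|[]]; last by exists B.
  by case: (cid2 e) => B' /= sB' /ginj; exact.
have [h _] := cardinal_nat Kcard; have [c Cc _] := Cunb (h 0%N).
by exists c; split=> // b [].
Qed.

Lemma inaccessible_nat_ub : inaccessible K ->
  forall h : nat -> K, exists c, forall n, h n < c.
Proof.
move=> [Kunc Kreg _] h.
have [a /card_le_belowP[g ginj ga]] := @card_trichotomy _ _ Kwo nat Kunc.
exact: regular_ub ginj ga.
Qed.

(** * Coding bounded sets and guessing tuples *)

Definition bounded (B : set K) := exists c, forall b, B b -> b < c.

(** This is the equality $2^{<\kappa}=\kappa$. *)
Definition bounded_code : Prop := exists phi : set K -> K,
  forall B B', bounded B -> bounded B' -> phi B = phi B' -> B = B'.

(** A stage above a bound of [B] that guesses [B] guesses all of it, so that stage determines [B]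
    and serves as its code. *)
Lemma diamond_bounded_code : diamond K -> bounded_code.
Proof.
move=> [A [_ Ast]].
have [phi phiP] : {phi : set K -> K & forall B, bounded B -> A (phi B) = B}.
  apply: (@choice _ _ (fun B c => bounded B -> A c = B)) => B.
  have [[a aB]|nb] := pselect (bounded B); last first.
    by have [h _] := cardinal_nat Kcard; exists (h 0%N) => /nb.
  have [c [Ac ac]] := Ast B _ (club_above a).
  have {}Ac : B `&` below c = A c := Ac.
  exists c => _; rewrite -Ac; apply/seteqP; split=> [b []//|b Bb].
  split=> //; exact: lt_trans (aB b Bb) ac.
by exists phi => B B' bB bB' e; rewrite -(phiP B bB) e phiP.
Qed.

(** Codes come in disjoint blocks: the subsets of [below a] are coded in a bounded block lying above
    all earlier blocks, which is possible by regularity and the strong limit property. *)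
Lemma inaccessible_bounded_code : inaccessible K -> bounded_code.
Proof.
move=> [_ Kreg Kstrong].
have [k0 _] := cardinal_nat Kcard; move: (k0 0%N) => {}k0.
(* A strictly increasing map with all values above [c0], used to move a block of codes past the
   earlier ones. *)
have climb (c0 : K) : exists psi : K -> K, forall k, c0 < psi k /\
    forall k', k' < k -> psi k' < psi k.
  apply: (wo_choice Kwo k0 (Q := fun k psi v => c0 < v /\ forall k', k' < k -> psi k' < v)).
    by move=> a f g v fg [? h]; split=> // b ba; rewrite -fg//; exact: h.
  move=> a f _; have [c1 h1] := Kreg a (fun b => f (\val b)).
  have [c h2 h3] := cardinal_ub2 Kcard c0 c1.
  exists c; split=> // b ba; apply: lt_trans h3.
  exact: (h1 (SigSub (mem_set (ba : below a b)))).
pose Q (a : K) (F : K -> (set K -> K)) (v : set K -> K) :=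
  [/\ forall B B', B `<=` below a -> B' `<=` below a -> v B = v B' -> B = B',
      exists c, forall B, v B < c &
      forall b B B', b < a -> v B <> F b B'].
have [|a f fQ|F FQ] := @wo_choice _ _ Kwo (set K -> K) (fun=> k0) Q.
- move=> a f g v fg [h1 h2 h3]; split=> // b B B' ba; rewrite -fg//; exact: h3.
- have [ub ubP] : {ub : K -> K & forall b, b < a -> forall B, f b B < ub b}.
    apply: (@choice _ _ (fun b c => b < a -> forall B, f b B < c)) => b.
    have [ba|nba] := boolP (b < a); last by exists a.
    by have [_ [c cP] _] := fQ b ba; exists c.
  have [c0 c0P] := Kreg a (fun b => ub (\val b)).
  have [psi psiP] := climb c0.
  have [c [g [gc ginj]]] := strong_limit_powerset Kstrong a.
  exists (fun B => psi (g B)); split.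
  + move=> B B' sB sB' e; apply: ginj => //; case: (ltgtP (g B) (g B')) => // h.
    * by have := (psiP _).2 _ h; rewrite e ltxx.
    * by have := (psiP _).2 _ h; rewrite e ltxx.
  + by exists (psi c) => B; apply: (psiP c).2.
  + move=> b B B' ba e; have := ubP b ba B'; rewrite -e.
    have /= := c0P (SigSub (mem_set (ba : below a b))).
    move=> h1 h2; have := (psiP (g B)).1; rewrite ltNge => /negP; apply.
    exact: ltW (lt_trans h2 h1).
- have [rk rkP] : {rk : set K -> K & forall B, bounded B -> B `<=` below (rk B)}.
    apply: (@choice _ _ (fun B c => bounded B -> B `<=` below c)) => B.
    by have [[a aB]|nb] := pselect (bounded B); [exists a|exists k0 => /nb].
  exists (fun B => F (rk B) B) => B B' bB bB' e.
  have [Finj _ Fdis] := FQ (rk B).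
  case: (ltgtP (rk B) (rk B')) => h.
  + by have [_ _ /(_ _ B' B h)] := FQ (rk B'); rewrite e.
  + by have := Fdis _ B B' h; rewrite e.
  + by apply: Finj; [exact: rkP|rewrite h; exact: rkP|rewrite e h].
Qed.

(** Kuratowski pairs, with the codes of unordered pairs in place of the pairs themselves. *)
Lemma bounded_pairing : bounded_code ->
  exists pair : K -> K -> K,
    forall a b a' b', pair a b = pair a' b' -> a = a' /\ b = b'.
Proof.
move=> [phi phiP].
have bnd2 a b : bounded [set a; b].
  by have [c ac bc] := cardinal_ub2 Kcard a b; exists c => _ [->|->].
exists (fun a b => phi [set phi [set a; a]; phi [set a; b]]).
move=> a b a' b' /(phiP _ _ (bnd2 _ _) (bnd2 _ _)) /seteqP[s1 s2].
have aa : a = a'.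
  have [/(phiP _ _ (bnd2 _ _) (bnd2 _ _)) /seteqP[_ /(_ a')]
       |/(phiP _ _ (bnd2 _ _) (bnd2 _ _)) /seteqP[_ /(_ a')]] := s1 _ (or_introl erefl).
  - by case=> //; left.
  - by case=> //; left.
split=> //; subst a'.
have [/(phiP _ _ (bnd2 _ _) (bnd2 _ _)) /seteqP[h _]
     |/(phiP _ _ (bnd2 _ _) (bnd2 _ _)) /seteqP[h h']] := s1 _ (or_intror erefl).
- have ba : b = a by have [] := h b (or_intror erefl).
  subst b; have [/(phiP _ _ (bnd2 _ _) (bnd2 _ _)) /seteqP[h' _]
     |/(phiP _ _ (bnd2 _ _) (bnd2 _ _)) /seteqP[h' _]] := s2 _ (or_intror erefl).
  + by have [] := h' b' (or_intror erefl).
  + by have [] := h' b' (or_intror erefl).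
- have [ba|//] := h b (or_intror erefl).
  by have [b'a|//] := h' b' (or_intror erefl); rewrite ba b'a.
Qed.

(** The graph of [u] below [a], written with coded pairs, is bounded by regularity and so has a
    code. Thus $\kappa^{<\kappa}=\kappa$. *)
Lemma restriction_code : regular K -> bounded_code ->
  exists code : (K -> K) -> K -> K, forall u a u' a',
    code u a = code u' a' -> a = a' /\ forall b, b < a -> u b = u' b.
Proof.
move=> Kreg Kcode; have [pair pairP] := bounded_pairing Kcode.
have [phi phiP] := Kcode.
have bnd (u : K -> K) (a : K) : bounded [set pair b (u b) | b in below a].
  have [c cP] := Kreg a (fun b => pair (\val b) (u (\val b))).
  by exists c => _ [b ba <-]; exact: (cP (SigSub (mem_set ba))).
exists (fun u a => pair a (phi [set pair b (u b) | b in below a])).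
move=> u a u' a' /pairP[<-] {a'} /(phiP _ _ (bnd _ _) (bnd _ _)) /seteqP[h _].
split=> // b ba; have [|b' _ /pairP[-> //]] := h (pair b (u b)).
by exists b.
Qed.

Lemma closure_club : regular K -> (forall h : nat -> K, exists c, forall n, h n < c) ->
  forall (g : K -> K) j, club [set c | j < c /\ forall b, b < c -> g b < c].
Proof.
move=> Kreg nat_ub g j; split=> [a0|a [b0 b0a] lim]; last first.
  split=> [|b ba]; first by have [c [jc _] /andP[_ ca]] := lim b0 b0a; exact: lt_trans ca.
  have [c [_ Cc] /andP[bc ca]] := lim b ba; exact: lt_trans (Cc b bc) ca.
have [a a0a ja] := cardinal_ub2 Kcard a0 j.
have [step stepP] : {step : K -> K & forall c, c < step c /\
    forall b, b < c -> g b < step c}.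
  apply: (@choice _ _ (fun c c' => c < c' /\ forall b, b < c -> g b < c')) => c.
  have [c1 h1] := Kreg c (fun b => g (\val b)).
  have [c2 h2 h3] := cardinal_ub2 Kcard c c1.
  exists c2; split=> // b bc; apply: lt_trans h3.
  exact: (h1 (SigSub (mem_set (bc : below c b)))).
pose h n := iter n step a.
have [|c cub cmin] := @wo_min _ _ Kwo [set c | forall n, h n < c].
  by have [c] := nat_ub h; exists c.
exists c; last exact: lt_trans (cub 0%N).
split=> [|b bc]; first exact: lt_trans (cub 0%N).
have [n bn] : exists n, b <= h n.
  apply: contrapT => nn; have := bc; rewrite ltNge => /negP; apply.
  by apply: cmin => n /=; rewrite ltNge; apply/negP => bn; apply: nn; exists n.
(* [step c] bounds [g] only at points strictly below [c], whence two steps from [h n]. *)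
apply: lt_trans (cub n.+2).
have [h1 _] := stepP (h n).
exact: (stepP (h n.+1)).2 _ (le_lt_trans bn h1).
Qed.

(** The [n] sets are merged into one by tagging elements with their index. A guess of the merged set
    can be decoded at stages closed under tagging, and these form a club. *)
Lemma tuple_guessing n : guessing -> regular K -> bounded_code ->
    (forall h : nat -> K, exists c, forall n, h n < c) ->
  exists G : K -> set ('I_n -> set K), (forall a, small (G a)) /\
    forall Z j, exists2 a, j < a & G a (fun i => Z i `&` below a).
Proof.
move=> [A [Asmall Ast]] Kreg Kcode nat_ub.
have [pair pairP] := bounded_pairing Kcode.
have [h hinj] := cardinal_nat Kcard.
pose tag (b : K) (i : 'I_n) := pair b (h i).
pose dec (a : K) (B : set K) (i : 'I_n) := [set b | b < a /\ B (tag b i)].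
have [g gP] : {g : K -> K & forall b i, tag b i < g b}.
  apply: (@choice _ _ (fun b c => forall i, tag b i < c)) => b.
  exact: cardinal_ub_fin.
exists (fun a => dec a @` A a); split=> [a|Z j].
  have [m [e eP]] := Asmall a; exists m, (fun b => dec a (e b)) => _ [B AB <-].
  by have [b bm <-] := eP B AB; exists b.
pose B := [set k | exists b i, Z i b /\ k = tag b i].
have [c [Ac [jc cg]]] := Ast B _ (closure_club Kreg nat_ub g j).
exists c => //; exists (B `&` below c) => //.
apply/funext => i; apply/seteqP; split=> b [].
- move=> bc [[b' [i' [Zb' e]]] _]; split=> //.
  by have [-> /hinj /val_inj ->] := pairP _ _ _ _ e.
- move=> Zb bc; split=> //; split; first by exists b, i.
  exact: lt_trans (gP b i) (cg b bc).
Qed.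
End Guessing.

(** * Topology of the Baire space *)

Section Topology.
Context d (K : orderType d) (Kcard : infinite_cardinal K).

Definition agree (x z : K -> K) (a : K) : Prop := forall b, b < a -> x b = z b.

Lemma agree_le (x z : K -> K) (a b : K) : a <= b -> agree x z b -> agree x z a.
Proof. by move=> ab xz c ca; apply: xz; exact: lt_le_trans ab. Qed.

Lemma agree_sym (x z : K -> K) (a : K) : agree x z a -> agree z x a.
Proof. by move=> xz b ba; rewrite xz. Qed.

Lemma agree_trans (x y z : K -> K) (a : K) : agree x y a -> agree y z a -> agree x z a.
Proof. by move=> xy yz b ba; rewrite xy// yz. Qed.

Lemma cone_restr (x z : baire K) (a : K) : cone (restr x a) z <-> agree x z a.
Proof.
split=> [h b ba|h b]; first by have /= -> := h (SigSub (mem_set (ba : below a b))).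
by rewrite /= h//; exact: set_mem (valP b).
Qed.

Lemma open_cone (p : short_seq K) : open (cone p : set (baire K)).
Proof.
exists [set cone p]; last by rewrite bigcup_set1.
move=> _ ->; apply: (@finI_from1 (set (baire K)) _ (range (@cone d K)) id).
by exists p.
Qed.

(** Basic open sets are finite intersections of cones; the finitely many lengths have a common
    bound, so one cone around [x] suffices. *)
Lemma nbhs_baireP (x : baire K) (A : set (baire K)) :
  nbhs x A <-> exists a, forall z : baire K, agree x z a -> A z.
Proof.
split; last first.
  move=> [a aA]; rewrite nbhsE; exists (cone (restr x a)).
    by split; [exact: open_cone|apply/cone_restr].
  by move=> z /cone_restr; exact: aA.
rewrite nbhsE => -[_ [[B sB <-] [C BC Cx]] sA].
have [D sD CE] := sB _ BC.
have [h _] := cardinal_nat Kcard.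
have [g gP] : {g : set (baire K) -> K & forall E, E \in D -> forall z : baire K,
    agree x z (g E) -> E z}.
  apply: (@choice _ _ (fun E a => E \in D -> forall z : baire K, agree x z a -> E z)) => E.
  have [ED|nED] := boolP (E \in D); last by exists (h 0%N).
  have [p _ pE] : range (@cone d K) E by exact: set_mem (sD _ ED).
   exists (len p) => _ z xz.
  have : E x by have : C x by []; rewrite -CE; apply.
  rewrite -pE => xp b; rewrite -xp; symmetry; apply: xz; exact: set_mem (valP b).
have [a aP] := cardinal_ub_fin Kcard (fun i : 'I_(size D) => g (nth set0 D i)).
exists a => z xz; apply: sA; exists C => //; change (C z); rewrite -CE => E ED.
apply: (gP E ED); apply: agree_le xz.
have iD : (index E D < size D)%N by rewrite index_mem.
by have := aP (Ordinal iD); rewrite /= nth_index// => /ltW.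
Qed.

Lemma closed_baire (C : set (baire K)) (x : baire K) : closed C -> ~ C x ->
  exists a, forall z : baire K, agree x z a -> ~ C z.
Proof.
move=> Ccl nCx; apply/nbhs_baireP; apply: open_nbhs_nbhs.
by split=> //; exact: closed_openC.
Qed.

Lemma continuous_baire (f : baire K -> baire K) (x : baire K) (a : K) :
  continuous f -> exists a', forall z : baire K, agree x z a' -> agree (f x) (f z) a.
Proof.
move=> /(_ x) fx.
have : nbhs (f x) [set z : baire K | agree (f x) z a] by apply/nbhs_baireP; exists a.
by move=> /fx /nbhs_baireP.
Qed.

Lemma closed_power n (X : set (baire K)) (R : set (power n (set_type X)))
    (y : 'I_n -> X) : closed R -> ~ R y ->
  exists a, forall z : 'I_n -> X,
    (forall i, agree (\val (y i)) (\val (z i)) a) -> ~ R z.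
Proof.
move=> Rcl nRy.
have : nbhs (y : power n (set_type X)) (~` R).
  by apply: open_nbhs_nbhs; split=> //; exact: closed_openC.
(* Tuples that agree with [y] up to one common length generate a filter, and convergence in the
   product may be checked one coordinate at a time. *)
pose F : set_system (forall i : 'I_n, X) := [set A | exists a, forall z : 'I_n -> X,
    (forall i, agree (\val (y i)) (\val (z i)) a) -> A z].
have FF : Filter F.
  split.
  - by have [h _] := cardinal_nat Kcard; exists (h 0%N).
  - move=> P Q [a aP] [b bQ]; exists (Order.max a b) => z h; split.
      by apply: aP => i; apply: agree_le (h i); rewrite le_max lexx.
    by apply: bQ => i; apply: agree_le (h i); rewrite le_max lexx orbT.
  - by move=> P Q PQ [a aP]; exists a => z /aP /PQ.
suff Fy : F --> (y : power n (set_type X)) by move/Fy.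
apply/cvg_sup => i A; rewrite nbhsE => -[_ [[_ [B Bo <-] <-] By] sA].
have /nbhs_baireP[a aB] : nbhs (\val (y i) : baire K) B by exact: open_nbhs_nbhs.
by exists a => z h; apply: sA; exact: aB.
Qed.

End Topology.

(** * Perfect sets from coherent splitting *)

Section Segments.
Context d (K : orderType d).

Lemma initial_seg_restr (x z : baire K) (a b : K) :
  initial_seg (restr x a) (restr z b) <-> a <= b /\ agree x z a.
Proof.
split=> [h|[ab xz] c].
  split=> [|c ca].
    rewrite leNgt; apply/negP => ba.
    have [/= c cb _] := h (SigSub (mem_set (ba : below a b))).
    have : b < b by rewrite -{1}cb; exact: set_mem (valP c).
    by rewrite ltxx.
  have [/= c' cc' e] := h (SigSub (mem_set (ca : below a c))).
  by rewrite -e cc'.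
have ca : \val c < a by exact: set_mem (valP c).
exists (SigSub (mem_set (lt_le_trans ca ab : below b (\val c)))) => //=.
by rewrite xz.
Qed.

Lemma restr_inj (x z : baire K) (a b : K) :
  restr x a = restr z b -> a = b /\ agree x z a.
Proof.
move=> e.
have /initial_seg_restr[ab xz] : initial_seg (restr x a) (restr z b).
  by rewrite -e; apply/initial_seg_restr.
have /initial_seg_restr[ba _] : initial_seg (restr z b) (restr x a).
  by rewrite e; apply/initial_seg_restr.
by split=> //; apply/le_anti/andP.
Qed.

Lemma initial_segE (p : short_seq K) (x : baire K) (a : K) :
  initial_seg p (restr x a) -> p = restr x (len p).
Proof.
case: p => b f h; rewrite /restr /len /=; congr existT.
apply/funext => c; have [c' e] := h c.
by rewrite /entry /= => <-; rewrite e.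
Qed.

End Segments.

Section PerfectRange.
Context d (K : orderType d) (Kcard : infinite_cardinal K) (Kreg : regular K).
(** [Z] codes a 0-1 sequence and [y Z] is the branch along it; [l a Z] is the coordinate at which
    the branches through the node [Z] restricted to [a] split according to membership of [a]. *)
Context (y : set K -> K -> K) (l : K -> set K -> K).

Let Kwo : well_order (<=%O : rel K). Proof. by case: Kcard. Qed.

Definition same_below (Z Z' : set K) (a : K) := forall b, b < a -> Z b <-> Z' b.

Context (l_ge : forall a Z, a <= l a Z).
Context (l_mono : forall a b Z, a <= b -> l a Z <= l b Z).
Context (l_split : forall a Z Z', same_below Z Z' a -> Z a -> ~ Z' a ->
  [/\ l a Z = l a Z', agree (y Z) (y Z') (l a Z) & y Z (l a Z) <> y Z' (l a Z)]).

Lemma first_difference (Z Z' : set K) : Z <> Z' ->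
  exists2 a, same_below Z Z' a & ~ (Z a <-> Z' a).
Proof.
move=> ne; have [|m nm mlb] := @wo_min _ _ Kwo [set a | ~ (Z a <-> Z' a)].
  apply: contrapT => h; apply: ne; apply/seteqP.
  have e a : Z a <-> Z' a by apply: contrapT => na; apply: h; exists a.
  by split=> a /e.
by exists m => // b bm; apply: contrapT => /mlb; rewrite leNgt bm.
Qed.

Lemma range_split (a : K) (Z Z' : set K) : same_below Z Z' a -> ~ (Z a <-> Z' a) ->
  [/\ l a Z = l a Z', agree (y Z) (y Z') (l a Z) & y Z (l a Z) <> y Z' (l a Z)].
Proof.
move=> s ns; have [Za|nZa] := pselect (Z a).
  by apply: l_split => // Z'a; apply: ns.
have Z'a : Z' a by apply: contrapT => h; apply: ns; split.
have [|->h1 h2] := l_split _ Z'a nZa; first by move=> b ba; split => /(s b ba).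
split=> //; first exact: agree_sym.
by move=> e; apply: h2.
Qed.

Lemma range_agree (a : K) (Z Z' : set K) : same_below Z Z' a -> agree (y Z) (y Z') a.
Proof.
move=> s; have [->//|/first_difference[b sb nb]] := pselect (Z = Z').
have [_ h _] := range_split sb nb; apply: agree_le h.
apply: le_trans (l_ge _ _); rewrite leNgt; apply/negP => ba.
exact/nb/s.
Qed.

(* [W] collects the splitting decisions of [Z i] that are visible below
   [lam i]. *)
Lemma range_chain (I : Type) (Z : I -> set K) (lam : I -> K) :
  (forall i j p, p < lam i -> p < lam j -> y (Z i) p = y (Z j) p) ->
  exists W, forall i, agree (y W) (y (Z i)) (lam i).
Proof.
move=> coh; pose W := [set a | exists2 i, l a (Z i) < lam i & Z i a].
exists W => i; have [->//|/first_difference[a sa na]] := pselect (W = Z i).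
have [e h _] := range_split sa na; apply: agree_le h.
rewrite leNgt; apply/negP => la; rewrite e in la.
have [Wa|nWa] := pselect (W a); last first.
  apply: na; split=> // Zia; exfalso; apply: nWa; exists i => //.
have nZa : ~ Z i a by move=> Za; apply: na.
have [j lj Zja] := Wa.
(* [Z i] and [Z j] part at or before [a], so by monotonicity of [l] their branches differ at a
   coordinate below both [lam i] and [lam j], against coherence. *)
have [b sb nb] : exists2 b, same_below (Z i) (Z j) b & ~ (Z i b <-> Z j b).
  by apply: first_difference => ij; rewrite -ij in Zja.
have ba : b <= a.
  rewrite leNgt; apply/negP => ab; apply: nZa; exact/(sb a ab).
have [e' _] := range_split sb nb; apply; apply: coh.
  by apply: le_lt_trans la; exact: l_mono.
by rewrite e'; apply: le_lt_trans lj; exact: l_mono.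
Qed.

Definition range_tree : set (short_seq K) :=
  [set p | exists Z a, p = restr (y Z : baire K) a].

(** Adding or removing [a] keeps the node below [a] and forces a split above it. For an increasing
    sequence of nodes, [range_chain] gives one branch through all of them, and regularity bounds
    their lengths. *)
Lemma range_perfect_tree : perfect_tree range_tree.
Proof.
split.
- by move=> p q pq [Z [a qE]]; rewrite qE in pq; exists Z, (len p); exact: initial_segE pq.
- move=> _ [Z [a ->]].
  pose Z1 := Z `|` [set a]; pose Z0 := Z `\` [set a].
  have ne b : b < a -> b <> a by move=> h e; rewrite e ltxx in h.
  have s1 : same_below Z Z1 a.
    by move=> b /ne ba; split=> [|[]//]; left.
  have s10 : same_below Z1 Z0 a.
    by move=> b /ne ba; split=> [[Zb|//]|[Zb _]]; [by split|by left].
  have [e h10 d10] : [/\ l a Z1 = l a Z0, agree (y Z1) (y Z0) (l a Z1)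
      & y Z1 (l a Z1) <> y Z0 (l a Z1)].
    by apply: l_split s10 _ _; [right|move=> [_]; apply].
  set m := l a Z1 in h10 d10.
  (* [m'] is the successor of [m], so restrictions to [m'] just include the splitting coordinate. *)
  have [m' m'P] : exists m', forall c, (c < m') = (c <= m).
    have [|m' mm' m'lb] := @wo_min _ _ Kwo [set c | m < c].
      by have [c] := cardinal_nomax Kcard m; exists c.
    exists m' => c; apply/idP/idP => [cm'|cm]; last exact: le_lt_trans mm'.
    by rewrite leNgt; apply/negP => /m'lb; rewrite leNgt cm'.
  have mm' : m <= m' by apply: ltW; rewrite m'P.
  exists (restr (y Z1 : baire K) m); split.
  + by exists Z1, m.
  + by apply/initial_seg_restr; split; [exact: l_ge|exact: range_agree].
  + exists (restr (y Z1 : baire K) m'), (restr (y Z0 : baire K) m'); split.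
    * by exists Z1, m'.
    * by exists Z0, m'.
    * by split; [apply/initial_seg_restr|move=> c; exact: m'P].
    * by split; [apply/initial_seg_restr|move=> c; exact: m'P].
    * by move/restr_inj => [_ h]; apply: d10; apply: h; rewrite m'P.
- move=> a s sT s_incr.
  have [Z ZP] : {Z : below a -> set K * K & forall b, s b = restr (y (Z b).1 : baire K) (Z b).2}.
    apply: (@choice _ _ (fun b p => s b = restr (y p.1 : baire K) p.2)) => b.
    by have [Z [c e]] := sT b; exists (Z, c).
  have [W WP] : exists W, forall b, agree (y W) (y (Z b).1) (Z b).2.
    apply: range_chain => i j p pi pj.
    case: (leP (\val i) (\val j)) => [ij|/ltW ij].
    + have := s_incr _ _ ij; rewrite !ZP => /initial_seg_restr[_ h]; exact: h.
    + have := s_incr _ _ ij; rewrite !ZP => /initial_seg_restr[_ h].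
      by symmetry; exact: h.
  have [c cP] := Kreg (fun b => (Z b).2).
  exists (restr (y W : baire K) c) => [|b]; first by exists W, c.
  rewrite ZP; apply/initial_seg_restr; split; first exact: ltW.
  exact: agree_sym.
Qed.

(** No new branches appear: the initial segments of a branch come from coherent members of the
    range, which [range_chain] with [lam] the identity glues into one. *)
Lemma range_perfect : perfect (range (y : set K -> baire K)).
Proof.
exists range_tree; first exact: range_perfect_tree.
apply/seteqP; split=> [_ [Z _ <-] a|x xT]; first by exists Z, a.
have [Z ZP] : {Z : K -> set K & forall a, agree x (y (Z a)) a}.
  apply: (@choice _ _ (fun a Z => agree x (y Z) a)) => a.
  by have [Z [b /restr_inj[_ h]]] := xT a; exists Z.
have [|W WP] := @range_chain _ Z id.
  by move=> i j p pi pj; rewrite -ZP// -ZP.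
exists W => //; apply/funext => b; have [c bc] := cardinal_nomax Kcard b.
by rewrite (WP c)// -ZP.
Qed.

End PerfectRange.

(** * The tree of conditions *)

Section Construction.
Context d (K : orderType d) (Kcard : infinite_cardinal K) (S : Type).
Context (D : set (set S)).
Context (D_closed : descending_closed K D).

Let Kwo : well_order (<=%O : rel K). Proof. by case: Kcard. Qed.

(** [E] takes care of the empty sequence, whose lower bound would otherwise be arbitrary. *)
Lemma lower_bound_under (E : set S) (a : K) (s : K -> set S) :
  D E -> (forall b, b < a -> D (s b)) -> (forall b, b < a -> s b `<=` E) ->
  (forall b c, b <= c -> c < a -> s c `<=` s b) ->
  exists L, [/\ D L, L `<=` E & forall b, b < a -> L `<=` s b].
Proof.
move=> DE Ds sE sdec.
have [[b0 b0a]|nb] := pselect (exists b, b < a); last first.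
  by exists E; split=> // b ba; exfalso; apply: nb; exists b.
have va (b : below a) : \val b < a by exact: set_mem (valP b).
have [|b c bc|L DL Ls] := @D_closed a (fun b => s (\val b)).
- by move=> b; apply: Ds.
- exact: sdec.
have Lb b : b < a -> L `<=` s b.
  by move=> ba; exact: (Ls (SigSub (mem_set (ba : below a b)))).
exists L; split=> //; exact: subset_trans (Lb _ b0a) (sE _ b0a).
Qed.

(* [Req b] stands for a dense open set in the pointwise order of families of
   conditions, which inherits closure under short descending sequences. *)
Lemma family_shrink (J : Type) (m : K) (Req : K -> (J -> set S) -> Prop)
    (E0 : J -> set S) :
  (forall z, D (E0 z)) ->
  (forall b E E', (forall z, E' z `<=` E z) -> Req b E -> Req b E') ->
  (forall b E, b < m -> (forall z, D (E z)) -> (forall z, E z `<=` E0 z) ->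
     exists E', [/\ forall z, D (E' z), forall z, E' z `<=` E z & Req b E']) ->
  exists E, [/\ forall z, D (E z), forall z, E z `<=` E0 z &
    forall b, b < m -> Req b E].
Proof.
move=> DE0 Rmono Rdense.
pose Q (b : K) (H : K -> J -> set S) (v : J -> set S) :=
  [/\ forall z, D (v z), forall c, c < b -> forall z, v z `<=` H c z,
      forall z, v z `<=` E0 z & b < m -> Req b v].
have [|b H HQ|H HQ] := @wo_choice _ _ Kwo _ E0 Q.
- by move=> b f g v fg [h1 h2 h3 h4]; split=> // c cb z; rewrite -fg//; exact: h2.
- have [E EP] : {E : J -> set S & forall z, [/\ D (E z), E z `<=` E0 z &
      forall c, c < b -> E z `<=` H c z]}.
    apply: (@choice _ _ (fun z L => [/\ D L, L `<=` E0 z & forall c, c < b -> L `<=` H c z])) => z.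
    apply: lower_bound_under => // [c /HQ[]//|c /HQ[]//|c c' cc' /HQ[_ h _ _]].
    by move: cc'; rewrite le_eqVlt => /orP[/eqP -> //|/h].
  have [bm|nbm] := boolP (b < m); last first.
    exists E; split=> [z|c cb z|z|bm]; last by rewrite bm in nbm.
    - by have [] := EP z.
    - by have [_ _] := EP z; apply.
    - by have [] := EP z.
  have [z|z|E' [h1 h2 h3]] := Rdense b E bm; [by have [] := EP z|by have [] := EP z|].
  exists E'; split=> // [c cb z|z]; apply: subset_trans (h2 z) _.
    by have [_ _] := EP z; apply.
  by have [] := EP z.
- have [h1 h2 h3 _] := HQ m.
  exists (H m); split=> // b bm.
  have [_ _ _ h4] := HQ b.
  exact: Rmono (h2 b bm) (h4 bm).
Qed.

Context (x y : S -> K -> K).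
Context (D_nonempty : forall B, D B -> B !=set0).

Definition split_at (B0 B1 : set S) (l : K) : Prop :=
  [/\ forall p q, (B0 `|` B1) p -> (B0 `|` B1) q -> agree (y p) (y q) l,
      forall p q, B0 p -> B0 q -> y p l = y q l,
      forall p q, B1 p -> B1 q -> y p l = y q l &
      forall p q, B0 p -> B1 q -> y p l <> y q l].

Context (D_split : forall B, D B -> exists B0 B1 l,
  [/\ D B0 /\ D B1, B0 `<=` B, B1 `<=` B & split_at B0 B1 l]).
Context (D_decide : forall B a, D B -> exists2 B', D B' &
  B' `<=` B /\ forall p q, B' p -> B' q -> agree (x p) (x q) a /\ agree (y p) (y q) a).
(** In the application [avoids j B] says that neighbourhoods of the conditions [B i] have a product
    missing the [j]-th closed part of the relation. *)
Context (n : nat) (avoids : K -> ('I_n -> set S) -> Prop).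
Context (avoids_mono : forall j B B', (forall i, B' i `<=` B i) ->
  avoids j B -> avoids j B').
Context (avoids_dense : forall j B, (forall i, D (B i)) ->
  (forall i i', i <> i' -> B i `&` B i' = set0) ->
  exists B', [/\ forall i, D (B' i), forall i, B' i `<=` B i & avoids j B']).
Context (G : K -> set ('I_n -> set K)) (G_small : forall a, small K (G a)).

(* [v.1 Z] is the condition at the node [Z] restricted to the ordinals [<= a],
   so that the two successors of the node [Z] restricted to [a] are both read
   off [v.1]; their points first differ at coordinate [v.2 Z]. *)
Definition stage (a : K) (F : K -> (set K -> set S) * (set K -> K))
    (v : (set K -> set S) * (set K -> K)) : Prop :=
  [/\ [/\ forall Z, D (v.1 Z),
      forall Z Z', same_below Z Z' a -> (Z a <-> Z' a) -> v.1 Z = v.1 Z',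
      forall Z Z', same_below Z Z' a -> v.2 Z = v.2 Z' &
      forall b Z, b < a -> v.1 Z `<=` (F b).1 Z],
    [/\ forall Z Z' p q, same_below Z Z' a -> v.1 Z p -> v.1 Z' q ->
        [/\ agree (x p) (x q) a, agree (y p) (y q) a & agree (y p) (y q) (v.2 Z)],
      forall Z p q, v.1 Z p -> v.1 Z q -> y p (v.2 Z) = y q (v.2 Z) &
      forall Z Z' p q, same_below Z Z' a -> Z a -> ~ Z' a ->
        v.1 Z p -> v.1 Z' q -> y p (v.2 Z) <> y q (v.2 Z)],
    (forall Z, a <= v.2 Z) /\ (forall b Z, b < a -> (F b).2 Z <= v.2 Z) &
    forall Zs, G a Zs -> (forall i i', i <> i' -> ~ same_below (Zs i) (Zs i') a) ->
      forall j, j < a -> forall Zs', (forall i, same_below (Zs' i) (Zs i) a) ->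
        avoids j (fun i => v.1 (Zs' i))].

Lemma same_belowI (Z : set K) (a b : K) : b <= a -> same_below (Z `&` below a) Z b.
Proof.
by move=> ba c cb; split=> [[]//|Zc]; split=> //; exact: lt_le_trans ba.
Qed.

Lemma same_below_eqI (Z Z' : set K) (a : K) :
  same_below Z Z' a <-> Z `&` below a = Z' `&` below a.
Proof.
split=> [s|e b ba].
  by apply/seteqP; split=> b [Zb ba]; split=> //; apply/(s b ba).
split=> Zb; first by have [] : (Z' `&` below a) b by rewrite -e.
by have [] : (Z `&` below a) b by rewrite e.
Qed.

(** First lower bounds of the earlier conditions are taken, then the guessed tuples are treated, and
    finally every condition is decided up to [a] and split. Splitting comes last because avoidance
    passes to smaller conditions. *)
Lemma stage_exists (a : K) (F : K -> (set K -> set S) * (set K -> K)) :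
  (forall b, b < a -> stage b F (F b)) -> exists v, stage a F v.
Proof.
move=> IH.
have locF b Z : b < a -> (F b).1 (Z `&` below a) = (F b).1 Z.
  move=> ba; have [[_ h _ _] _ _ _] := IH b ba; apply: h.
    by apply: same_belowI; exact: ltW.
  by split=> [[]|].
have [k0 _] := cardinal_nat Kcard; move: (k0 0%N) => {}k0.
have [L LP] : {L : set K -> set S & forall Z, D (L Z) /\
    forall b, b < a -> L Z `<=` (F b).1 Z}.
  apply: (@choice _ _ (fun Z B => D B /\ forall b, b < a -> B `<=` (F b).1 Z)) => Z.
  have va (b : below a) : \val b < a by exact: set_mem (valP b).
  have [b|b c bc|B DB Bs] := @D_closed a (fun b => (F (\val b)).1 Z).
  - by have [[h _ _ _] _ _ _] := IH _ (va b); exact: h.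
  - move: bc; rewrite le_eqVlt => /orP[/eqP -> //|bc].
    by have [[_ _ _ h] _ _ _] := IH _ (va c); exact: h.
  exists B; split=> // b ba; exact: (Bs (SigSub (mem_set (ba : below a b)))).
(* Cutting [Z] down to [below a] makes the chosen lower bound depend on the node alone. *)
pose E0 Z := L (Z `&` below a).
have E0F b Z : b < a -> E0 Z `<=` (F b).1 Z.
  by move=> ba; rewrite -locF//; exact: (LP _).2.
(* Distinct nodes were separated at an earlier stage, where their points received different values
   at a splitting coordinate. *)
have E0disj Z Z' : ~ same_below Z Z' a -> E0 Z `&` E0 Z' = set0.
  move=> ns; rewrite -subset0 => p [p1 p2].
  have ne : Z <> Z' by move=> ZZ; apply: ns => b _; rewrite ZZ.
  have [b sb nb] := first_difference Kcard ne.
  have ba : b < a.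
    rewrite ltNge; apply/negP => ab; apply: ns => c ca; apply: sb.
    exact: lt_le_trans ab.
  have [_ [_ _ ydiff] _ _] := IH b ba.
  have {}p1 := E0F b Z ba p p1; have {}p2 := E0F b Z' ba p p2.
  have [Zb|nZb] := pselect (Z b).
    by apply: (ydiff Z Z' p p sb Zb) => // Z'b; apply: nb.
  have Z'b : Z' b by apply: contrapT => h; apply: nb; split.
  by apply: (ydiff Z' Z p p _ Z'b nZb) => // c cb; split=> /(sb c cb).
have DE0 Z : D (E0 Z) by exact: (LP _).1.
have [m [e eP]] := G_small a.
pose distinct (Zs : 'I_n -> set K) := forall i i', i <> i' -> ~ same_below (Zs i) (Zs i') a.
pose Req (b : K) (E : set K -> set S) := distinct (e b) ->
  forall j, j < a -> avoids j (fun i => E (e b i `&` below a)).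
(* The outer shrinking runs through the guesses [e b], the inner one through the closed parts
   [j < a]. *)
have [E1 [DE1 E1E0 E1av]] : exists E1, [/\ forall Z, D (E1 Z), forall Z, E1 Z `<=` E0 Z &
    forall b, b < m -> Req b E1].
  apply: family_shrink => // [b E E' EE' R dis j ja|b E bm DE EE0].
    by apply: avoids_mono (R dis j ja) => i; exact: EE'.
  have [dis|ndis] := pselect (distinct (e b)); last first.
    by exists E; split=> [//|z|dis]; [exact: subset_refl|case: (ndis dis)].
  have dise i i' : i <> i' -> e b i `&` below a <> e b i' `&` below a.
    by move=> /dis h /same_below_eqI.
  have [||E' [h1 h2 h3]] := @family_shrink (set K) a
      (fun j (E : set K -> set S) => avoids j (fun i => E (e b i `&` below a))) E DE.
  - by move=> j E2 E2' EE'; apply: avoids_mono => i; exact: EE'.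
  - move=> j E2 ja DE2 E2E.
    have [||B' [DB' B'E2 B'av]] := @avoids_dense j (fun i => E2 (e b i `&` below a)).
    + by move=> i; exact: DE2.
    + move=> i i' ii'; rewrite -subset0 => p [/E2E /EE0 p1 /E2E /EE0 p2].
      have : (E0 (e b i) `&` E0 (e b i')) p.
        by split; [move: p1|move: p2]; rewrite /E0 -setIA setIid.
      by rewrite E0disj//; exact: dis.
    (* Only the conditions at the [n] nodes of the tuple change; these nodes are distinct, so the
       replacement is unambiguous. *)
    exists (fun Z => if pselect (exists i, e b i `&` below a = Z) is left h
      then B' (sval (cid h)) else E2 Z).
    have E3 i : (if pselect (exists i', e b i' `&` below a = e b i `&` below a) is left h
      then B' (sval (cid h)) else E2 (e b i `&` below a)) = B' i.
      case: pselect => [h|[]]; last by exists i.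
      case: (cid h) => i' /= ii'; have [->//|ne] := pselect (i' = i).
      by case: (dise _ _ ne).
    split=> [Z|Z|].
    + by case: pselect.
    + case: pselect => h; last exact: subset_refl.
      by case: (cid h) => i /= <-.
    + by apply: avoids_mono B'av => i; rewrite E3.
  - by exists E'; split=> // _.
(* Deciding up to [a] precedes splitting, so that both halves follow one initial segment of length
   [a]. *)
have [sp spP] : {sp : set S -> (set S * set S) * K & forall B, D B ->
    [/\ D (sp B).1.1 /\ D (sp B).1.2, (sp B).1.1 `<=` B, (sp B).1.2 `<=` B,
     split_at (sp B).1.1 (sp B).1.2 (sp B).2 &
     forall p q, ((sp B).1.1 `|` (sp B).1.2) p -> ((sp B).1.1 `|` (sp B).1.2) q ->
       agree (x p) (x q) a /\ agree (y p) (y q) a]}.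
  apply: (@choice _ _ (fun B (s : (set S * set S) * K) => D B ->
    [/\ D s.1.1 /\ D s.1.2, s.1.1 `<=` B, s.1.2 `<=` B, split_at s.1.1 s.1.2 s.2 &
     forall p q, (s.1.1 `|` s.1.2) p -> (s.1.1 `|` s.1.2) q ->
       agree (x p) (x q) a /\ agree (y p) (y q) a])) => B.
  have [DB|nDB] := pselect (D B); last by exists ((B, B), k0) => /nDB.
  have [B' DB' [B'B B'dec]] := D_decide a DB.
  have [B0 [B1 [l [DB01 B0B B1B sepB]]]] := D_split DB'.
  exists ((B0, B1), l) => _; split=> //=; [exact: subset_trans B'B|exact: subset_trans B'B|].
  by move=> p q [/B0B|/B1B] p' [/B0B|/B1B] q'; exact: B'dec.
pose E Z := E1 (Z `&` below a).
have DE Z : D (E Z) by exact: DE1.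
have EF b Z : b < a -> E Z `<=` (F b).1 Z.
  move=> ba p /E1E0; rewrite /E0 -setIA setIid; exact: (E0F b Z ba).
have EE Z Z' : same_below Z Z' a -> E Z = E Z' by move=> /same_below_eqI; rewrite /E => ->.
pose l Z := (sp (E Z)).2.
pose V Z := if pselect (Z a) then (sp (E Z)).1.2 else (sp (E Z)).1.1.
have VU Z : V Z `<=` (sp (E Z)).1.1 `|` (sp (E Z)).1.2.
  by rewrite /V; case: pselect => h p; [right|left].
have VE Z : V Z `<=` E Z.
  by have [_ h1 h2 _ _] := spP _ (DE Z); rewrite /V; case: pselect.
(* One point from each half: their difference at [l Z] shows that [l Z] is neither below [a] nor
   below an earlier splitting coordinate, since points of one condition agree there. *)
have halves Z : exists p q, [/\ E Z p, E Z q, agree (x p) (x q) a /\ agree (y p) (y q) a &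
    y p (l Z) <> y q (l Z)].
  have [[D0 D1] h1 h2 [_ _ _ h3] h4] := spP _ (DE Z).
  have [p p0] := D_nonempty D0; have [q q1] := D_nonempty D1.
  exists p, q; split; [exact: h1|exact: h2| |exact: h3].
  by apply: h4; [left|right].
exists (V, l); split; [split|split|split|] => /=.
- by move=> Z; have [[D0 D1] _ _ _ _] := spP _ (DE Z); rewrite /V; case: pselect.
- move=> Z Z' s sa; rewrite /V (EE _ _ s).
  by case: pselect => h; case: pselect => h' //; [case: h'|case: h]; apply/sa.
- by move=> Z Z' s; rewrite /l (EE _ _ s).
- by move=> b Z ba; exact: subset_trans (VE Z) (EF b Z ba).
- move=> Z Z' p q s /VU p' /VU; rewrite -(EE _ _ s) => q'.
  have [_ _ _ [h1 _ _ _] h2] := spP _ (DE Z).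
  by have [h3 h4] := h2 _ _ p' q'; split=> //; exact: h1.
- move=> Z p q; have [_ _ _ [_ h1 h2 _] _] := spP _ (DE Z).
  by rewrite /V; case: pselect => h; [exact: h2|exact: h1].
- move=> Z Z' p q s Za nZ'a; rewrite /V -(EE _ _ s).
  have [_ _ _ [_ _ _ h] _] := spP _ (DE Z).
  case: pselect => // hZ; case: pselect => // hZ' p' q' e'.
  by apply: h q' p' _; rewrite -[in RHS]/(l Z) e'.
- move=> Z; have [p [q [_ _ [_ h] ne]]] := halves Z.
  by rewrite leNgt; apply/negP => la; apply: ne; exact: h.
- move=> b Z ba; have [p [q [Ep Eq _ ne]]] := halves Z.
  have [_ [h1 h2 _] _ _] := IH b ba.
  have Fp := EF b Z ba p Ep; have Fq := EF b Z ba q Eq.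
  rewrite leNgt; apply/negP => lb; apply: ne.
  by have [_ _] := h1 Z Z p q (fun _ _ => iff_refl _) Fp Fq; apply.
- move=> Zs GZs dis j ja Zs' s.
  have [b bm eb] := eP _ GZs.
  have := E1av b bm; rewrite /Req eb => /(_ dis j ja).
  apply: avoids_mono => i; apply: subset_trans (@VE (Zs' i)) _.
  by rewrite (EE _ _ (s i)).
Qed.

Lemma tower_exists : (exists B, D B) -> exists F, forall a, stage a F (F a).
Proof.
move=> [B _]; have [h _] := cardinal_nat Kcard.
apply: (wo_choice Kwo (fun=> B, fun=> h 0%N)); last exact: stage_exists.
move=> a f g v fg [[h1 h2 h3 h4] h5 [h6 h7] h8]; split=> //; split=> // b Z ba.
  by rewrite -fg//; exact: h4.
by rewrite -fg//; exact: h7.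
Qed.

End Construction.

(** * Condensation points of an ideal *)

Section Positive.
Context d (K : orderType d) (Kcard : infinite_cardinal K) (S : Type).
Context (I : set (set S)) (I0 : I set0).
Context (I_sub : forall A B, A `<=` B -> I B -> I A).
Context (I_setU : forall A B, I A -> I B -> I (A `|` B)).
Context (I_bigcup : forall A : K -> set S, (forall c, I (A c)) -> I (\bigcup_c A c)).
Context (D : set (set S)) (D_pos : forall B, D B -> ~ I B).
Context (D_dense : forall A B, D B -> A `<=` B -> ~ I A -> exists2 B', D B' & B' `<=` A).
Context (D_single : forall B p, D B -> B p -> I [set p]).
Context (x y : S -> K -> K) (y_inj : injective y).

(** The preimages [x p] are followed along with the points [y p], because an analytic set need not
    be closed while the domain of its parametrization is. *)
Definition nearby (p : S) (a : K) : set S :=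
  [set q | agree (x p) (x q) a /\ agree (y p) (y q) a].

Context (code : S -> K -> K).
Context (codeP : forall p a q b, code p a = code q b -> a = b /\ nearby p a q).

Definition condensation (B : set S) : set S :=
  [set p | B p /\ forall a, ~ I (B `&` nearby p a)].

(** Points of [B] that are not condensation points are sorted by the code of a bad neighbourhood.
    Each of these kappa many classes lies inside one set of the ideal, and so does their union by
    completeness. *)
Lemma condensation_pos (B : set S) : ~ I B -> ~ I (condensation B).
Proof.
move=> BI gI; apply: BI.
pose bad c := [set p | B p /\ exists a, code p a = c /\ I (B `&` nearby p a)].
have : I (condensation B `|` \bigcup_c bad c).
  apply: I_setU => //; apply: I_bigcup => c.
  have [[p [Bp [a [pc Ia]]]]|ne] := pselect (exists p, bad c p); last first.
    by apply: I_sub I0 => p pc; apply: ne; exists p.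
  apply: I_sub Ia => q [Bq [b [qc _]]]; split=> //.
  by have [|] := @codeP p a q b; first by rewrite pc.
apply: I_sub => p Bp; have [pg|] := pselect (forall a, ~ I (B `&` nearby p a)).
  by left.
by rewrite -existsNE => -[a /contrapT aI]; right; exists (code p a) => //; split=> //; exists a.
Qed.

Lemma pos_nonempty (A : set S) : ~ I A -> A !=set0.
Proof.
by move=> AI; apply: contrapT => h; apply: AI; apply: I_sub I0 => p Ap; apply: h; exists p.
Qed.

Lemma D_near (B : set S) (p : S) (a : K) : D B -> condensation B p ->
  exists B', [/\ D B', B' `<=` B & B' `<=` nearby p a].
Proof.
move=> DB [Bp /(_ a) pos].
have [|B' DB' B'B] := D_dense DB _ pos; first by move=> q [].
by exists B'; split=> // q /B'B [].
Qed.

Lemma near_trans p q r a : nearby p a q -> nearby p a r -> nearby q a r.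
Proof.
by move=> [h1 h2] [h3 h4]; split; apply: agree_trans; [apply: agree_sym h1| |apply: agree_sym h2|].
Qed.

Lemma D_decide (B : set S) (a : K) : D B -> exists2 B', D B' &
  B' `<=` B /\ forall p q, B' p -> B' q -> agree (x p) (x q) a /\ agree (y p) (y q) a.
Proof.
move=> DB; have [p pB] := pos_nonempty (condensation_pos (D_pos DB)).
have [B' [DB' B'B B'p]] := D_near a DB pB.
exists B' => //; split=> // q r /B'p pq /B'p pr; exact: near_trans pq pr.
Qed.

(** As singletons are in the ideal, [B] has two condensation points. Conditions close enough to them
    split at the first coordinate where the two points differ. *)
Lemma D_split (B : set S) : D B -> exists B0 B1 l,
  [/\ D B0 /\ D B1, B0 `<=` B, B1 `<=` B & split_at y B0 B1 l].
Proof.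
move=> DB; have posB := condensation_pos (D_pos DB).
have [p pB] := pos_nonempty posB.
have [q qB qp] : exists2 q, condensation B q & q <> p.
  apply: contrapT => h; apply: posB; apply: I_sub (D_single DB pB.1) => q qB.
  by apply: contrapT => qp; apply: h; exists q.
have Kwo : well_order (<=%O : rel K) by case: Kcard.
have [|l ne lmin] := @wo_min _ _ Kwo [set b | y p b <> y q b].
  apply: contrapT => h; apply: qp; apply: y_inj; apply/funext => b.
  by apply: contrapT => ne; apply: h; exists b => /esym.
have pq : agree (y p) (y q) l.
  by move=> b bl; apply: contrapT => /lmin; rewrite leNgt bl.
(* Agreement up to [l'] covers only coordinates below [l'], and coordinate [l] has to be
   included. *)
have [l' ll'] := cardinal_nomax Kcard l.
have [B0 [DB0 B0B B0p]] := D_near l' DB pB.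
have [B1 [DB1 B1B B1q]] := D_near l' DB qB.
have yB0 r b : B0 r -> b < l' -> y r b = y p b by move=> /B0p [_ h] /h.
have yB1 r b : B1 r -> b < l' -> y r b = y q b by move=> /B1q [_ h] /h.
exists B0, B1, l; split=> //; split.
- have h r : (B0 `|` B1) r -> agree (y p) (y r) l.
    move=> [] rB b bl; first by rewrite (yB0 _ _ rB)//; exact: lt_trans ll'.
    by rewrite (yB1 _ _ rB) ?pq//; exact: lt_trans ll'.
  by move=> r s /h pr /h ps; apply: agree_trans ps; exact: agree_sym.
- by move=> r s rB sB; rewrite (yB0 r)// (yB0 s).
- by move=> r s rB sB; rewrite (yB1 r)// (yB1 s).
- by move=> r s rB sB; rewrite (yB0 r)// (yB1 s).
Qed.

End Positive.

(** * Limits of decreasing conditions *)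

Section Limits.
Context d (K : orderType d) (Kcard : infinite_cardinal K) (S : Type).
Context (V : K -> set S) (x : S -> K -> K).
Context (V_nonempty : forall a, V a !=set0).
Context (V_decr : forall a b, a < b -> V b `<=` V a).
Context (V_agree : forall a p q, V a p -> V a q -> agree (x p) (x q) a).

Lemma limit_branch : exists z : K -> K, forall a p, V a p -> agree (x p) z a.
Proof.
have [pt ptP] : {pt : K -> S & forall a, V a (pt a)}.
  exact: (@choice _ _ V).
have [s sP] : {s : K -> K & forall b, b < s b}.
  by apply: (@choice _ _ (fun b c => b < c)); exact: cardinal_nomax.
(* [V b] decides only coordinates below [b], so coordinate [b] is read at the later stage [s b]. *)
exists (fun b => x (pt (s b)) b) => a p Vp b ba.
case: (ltgtP a (s b)) => h.
- exact: V_agree Vp (V_decr h (ptP _)) b ba.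
- exact: V_agree (V_decr h Vp) (ptP _) b (sP b).
- by apply: (V_agree Vp) ba; rewrite h.
Qed.

End Limits.

(** * Consequences of the hypotheses *)

Section Dichotomy.
Context d (K : orderType d) (Kcard : infinite_cardinal K).

Lemma closed_enumeration (T : topologicalType) (R : set T) : kappa_Fsigma K R ->
  exists C : K -> set T, (forall j, closed (C j)) /\ R = \bigcup_j C j.
Proof.
move=> [F [FK Fcl ->]].
have [|g ginj] := (card_leTP F K).1; first by rewrite (card_le_eql (card_setT _)).
exists (fun j => if pselect (exists A, g A = j) is left h then \val (sval (cid h)) else set0).
split=> [j|].
  case: pselect => h; last exact: closed0.
  by apply: Fcl; exact: set_mem (valP _).
apply/seteqP; split=> z [].
- move=> A FA Az; exists (g (SigSub (mem_set FA))) => //.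
  case: pselect => [h|[]]; last by exists (SigSub (mem_set FA)).
  by case: (cid h) => A' /= /ginj ->.
- move=> j _; case: pselect => h //= Az; exists (\val (sval (cid h))) => //.
  exact: set_mem (valP _).
Qed.

(** Otherwise trichotomy in [S] would embed [Y] in a proper initial segment of [S], which has size
    at most kappa. *)
Lemma card_gt_succ e (S : orderType e) T (Y : set T) : successor_cardinal K S ->
  ~ (Y #<= [set: K]) -> exists g : S -> Y, injective g.
Proof.
move=> [Swo _ Sb] YK; apply/card_leTP; apply: contrapT => SY; apply: YK.
have [c Yc] := card_trichotomy Swo SY.
by have := card_le_trans Yc (Sb c); rewrite (card_le_eql (card_setT _)).
Qed.

Lemma guessing_hypotheses : diamond K \/ inaccessible K ->
  [/\ regular K, guessing K, bounded_code K &
    forall h : nat -> K, exists c, forall n, h n < c].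
Proof.
case=> H; split.
- exact: diamond_regular.
- exact: diamond_guessing.
- exact: diamond_bounded_code.
- exact: diamond_nat_ub.
- by case: H.
- exact: inaccessible_guessing.
- exact: inaccessible_bounded_code.
- exact: inaccessible_nat_ub.
Qed.

Lemma point_code (S : Type) (x y : S -> K -> K) : regular K -> bounded_code K ->
  exists code : S -> K -> K, forall p a q b, code p a = code q b ->
    a = b /\ nearby x y p a q.
Proof.
move=> Kreg Kcode; have [pair pairP] := bounded_pairing Kcard Kcode.
have [code codeP] := restriction_code Kcard Kreg Kcode.
exists (fun p a => pair (code (x p) a) (code (y p) a)) => p a q b.
by move=> /pairP[/codeP[-> h1] /codeP[_ h2]].
Qed.

(* The positive singletons are split off: an ideal is principal when it
   contains the set of all points whose singletons it contains. *)
Lemma I_minus_conditions e (S : orderType e) (I : set (set S)) (D : set (set S)) :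
    successor_cardinal K S -> ideal I -> complete_ideal I -> ~ principal_ideal I ->
    dense_in D (~` I) -> descending_closed K D ->
  exists D' : set (set S), [/\ exists B, D' B, forall B, D' B -> ~ I B,
    forall A B, D' B -> A `<=` B -> ~ I A -> exists2 B', D' B' & B' `<=` A,
    forall B p, D' B -> B p -> I [set p] & descending_closed K D'].
Proof.
move=> succS [I0 IT I_sub I_setU] Icomp Inp [Dpos Ddense] Dclosed.
pose Q := [set p | I [set p]].
have posQ : ~ I Q.
  move=> IQ; apply: Inp; exists Q; apply/seteqP; split=> B.
    by move=> IB p Bp; apply: I_sub IB => q ->.
  by move=> BQ; exact: I_sub IQ.
have [Q' DQ' Q'Q] := Ddense _ posQ.
exists [set B | D B /\ B `<=` Q]; split.
- by exists Q'.
- by move=> B [/Dpos].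
- move=> A B [_ BQ] AB posA; have [B' DB' B'A] := Ddense _ posA.
  by exists B' => //; split=> //; apply: subset_trans B'A (subset_trans AB BQ).
- by move=> B p [_ BQ] /BQ.
- move=> a s sD sdec.
  (* For the empty sequence the closure of [D] gives a bound that may leave [Q], so [Q'] is used
     instead. *)
  have [[b _]|nb] := pselect (exists b : below a, True); last first.
    by exists Q' => // b; exfalso; apply: nb; exists b.
  have [|L DL Ls] := Dclosed a s _ sdec; first by move=> c; have [] := sD c.
  by exists L => //; split=> //; apply: subset_trans (Ls b) (sD b).2.
Qed.

Lemma complete_bigcup e (S : orderType e) (I : set (set S)) :
  successor_cardinal K S -> complete_ideal I ->
  forall A : K -> set S, (forall c, I (A c)) -> I (\bigcup_c A c).
Proof.
move=> [_ nSK _] Icomp A AI.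
have -> : \bigcup_c A c = \bigcup_(B in range A) B.
  by apply/seteqP; split=> p; [move=> [c _ Ap]; exists (A c) => //; exists c
    |move=> [_ [c _ <-] Ap]; exists c].
apply: Icomp => [_ [c _ <-]//|SA]; apply: nSK.
exact: card_le_trans SA (card_image_le _ _).
Qed.

End Dichotomy.

(** * The dichotomy *)

Section Assembly.
Context d (K : orderType d) (Kcard : infinite_cardinal K) (Kreg : regular K).
Context (S : Type) (D : set (set S)) (x y : S -> K -> K) (n : nat).
Context (avoids : K -> ('I_n -> set S) -> Prop).
Context (G : K -> set ('I_n -> set K)).
Context (G_guess : forall Z j, exists2 a, j < a & G a (fun i => Z i `&` below a)).
Context (F : K -> (set K -> set S) * (set K -> K)).
Context (F_stage : forall a, stage D x y avoids G a F (F a)).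
Context (D_nonempty : forall B, D B -> B !=set0).

Lemma tower_nonempty a Z : (F a).1 Z !=set0.
Proof. by have [[h _ _ _] _ _ _] := F_stage a; exact: D_nonempty. Qed.

Lemma tower_decr a b Z : a <= b -> (F b).1 Z `<=` (F a).1 Z.
Proof.
rewrite le_eqVlt => /orP[/eqP -> //|ab].
by have [[_ _ _ h] _ _ _] := F_stage b; exact: h.
Qed.

Lemma tower_agree a Z p q : (F a).1 Z p -> (F a).1 Z q ->
  agree (x p) (x q) a /\ agree (y p) (y q) a.
Proof.
move=> Zp Zq; have [_ [h _ _] _ _] := F_stage a.
by have [//|] := h Z Z p q _ Zp Zq.
Qed.

Lemma tower_limit : exists xZ yZ : set K -> K -> K, forall Z a p, (F a).1 Z p ->
  agree (x p) (xZ Z) a /\ agree (y p) (yZ Z) a.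
Proof.
have [xZ xP] : {xZ : set K -> K -> K & forall Z a p, (F a).1 Z p -> agree (x p) (xZ Z) a}.
  apply: (@choice _ _ (fun Z z => forall a p, (F a).1 Z p -> agree (x p) z a)) => Z.
  apply: (limit_branch Kcard) => [a|a b /ltW|a p q Zp Zq].
  - exact: tower_nonempty.
  - exact: tower_decr.
  - exact: (tower_agree Zp Zq).1.
have [yZ yP] : {yZ : set K -> K -> K & forall Z a p, (F a).1 Z p -> agree (y p) (yZ Z) a}.
  apply: (@choice _ _ (fun Z z => forall a p, (F a).1 Z p -> agree (y p) z a)) => Z.
  apply: (limit_branch Kcard) => [a|a b /ltW|a p q Zp Zq].
  - exact: tower_nonempty.
  - exact: tower_decr.
  - exact: (tower_agree Zp Zq).2.
by exists xZ, yZ => Z a p Zp; split; [exact: xP|exact: yP].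
Qed.

Context (xZ yZ : set K -> K -> K).
Context (limitP : forall Z a p, (F a).1 Z p -> agree (x p) (xZ Z) a /\ agree (y p) (yZ Z) a).

Lemma tower_perfect : perfect (range (yZ : set K -> baire K)).
Proof.
apply: (@range_perfect _ _ Kcard Kreg yZ (fun a => (F a).2)).
- by move=> a Z; have [_ _ [h _] _] := F_stage a; exact: h.
- move=> a b Z; rewrite le_eqVlt => /orP[/eqP -> //|ab].
  by have [_ _ [_ h] _] := F_stage b; exact: h.
move=> a Z Z' s Za nZ'a; have [[_ _ lE _] [agr _ dif] _ _] := F_stage a.
split; first exact: lE.
  (* Points of a stage [b] share with the limit only coordinates below [b], so [b] is taken beyond
     the splitting coordinate. *)
  have [b ab lb] := cardinal_ub2 Kcard a ((F a).2 Z).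
  have [p Zp] := tower_nonempty b Z; have [q Zq] := tower_nonempty b Z'.
  have [_ _ h] := agr Z Z' p q s (tower_decr (ltW ab) Zp) (tower_decr (ltW ab) Zq).
  move=> c cl; have cb := lt_trans cl lb.
  by rewrite -((limitP Zp).2 c cb) -((limitP Zq).2 c cb) h.
have [b ab lb] := cardinal_ub2 Kcard a ((F a).2 Z).
have [p Zp] := tower_nonempty b Z; have [q Zq] := tower_nonempty b Z'.
rewrite -((limitP Zp).2 _ lb) -((limitP Zq).2 _ lb).
exact: dif s Za nZ'a (tower_decr (ltW ab) Zp) (tower_decr (ltW ab) Zq).
Qed.

(** [xZ Z] is a limit of points [x p] of the closed set [C], and continuity carries [f (x p) = y p]
    over to the limits. *)
Lemma tower_image (C : set (baire K)) (f : baire K -> baire K) (Z : set K) :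
  closed C -> continuous f -> (forall p, C (x p)) -> (forall p, f (x p) = y p) ->
  C (xZ Z) /\ f (xZ Z) = yZ Z.
Proof.
move=> Ccl fcont Cx fx; split.
  apply: contrapT => /(closed_baire Kcard Ccl) [a ha].
  have [p Zp] := tower_nonempty a Z.
  by apply: ha (Cx p); apply: agree_sym; exact: (limitP Zp).1.
apply/funext => b; have [c bc] := cardinal_nomax Kcard b.
have [a ha] := continuous_baire Kcard (xZ Z) c fcont.
have [e ce ae] := cardinal_ub2 Kcard c a.
have [p Zp] := tower_nonempty e Z.
have [h1 h2] := limitP Zp.
rewrite (ha (x p)) ?fx//; first by rewrite h2//; exact: lt_trans ce.
by apply: agree_sym; apply: agree_le h1; exact: ltW.
Qed.

(** Distinct sets are told apart below some [c]. A stage beyond [c] and [j] at which the tuple is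
    guessed has treated it for the part [j]. *)
Lemma tower_avoids (Zs : 'I_n -> set K) (j : K) : injective Zs ->
  exists a, avoids j (fun i => (F a).1 (Zs i)).
Proof.
move=> Zinj.
have [g gP] : {g : 'I_n -> K & forall i, forall i', i <> i' -> ~ same_below (Zs i) (Zs i') (g i)}.
  apply: (@choice _ _ (fun i a => forall i', i <> i' -> ~ same_below (Zs i) (Zs i') a)) => i.
  have [h hP] : {h : 'I_n -> K & forall i', i <> i' -> ~ same_below (Zs i) (Zs i') (h i')}.
    apply: (@choice _ _ (fun i' a => i <> i' -> ~ same_below (Zs i) (Zs i') a)) => i'.
    have [->|ne] := pselect (i = i'); first by exists j.
    have [|a _ na] := @first_difference _ _ Kcard (Zs i) (Zs i'); first by move=> /Zinj.
    have [b ab] := cardinal_nomax Kcard a.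
    by exists b => _ s; apply: na; exact: s.
  have [a aP] := cardinal_ub_fin Kcard h.
  exists a => i' ii' s; apply: (hP i' ii') => b bh; apply: s.
  exact: lt_trans (aP i').
have [c cP] := cardinal_ub_fin Kcard g.
have [m cm jm] := cardinal_ub2 Kcard c j.
have [a ma Ga] := G_guess Zs m.
have [_ _ _ h] := F_stage a.
exists a; apply: (h _ Ga) => [i i' ii' s||i].
- apply: (gP i i' ii') => b bg.
  have ba : b < a by apply: lt_trans bg (lt_trans (cP i) (lt_trans cm ma)).
  have [s1 s2] := s b ba; split=> Zb.
    by have [] : (Zs i' `&` below a) b by apply: s1.
  by have [] : (Zs i `&` below a) b by apply: s2.
- exact: lt_trans jm ma.
- move=> b ba; have [h1 h2] := same_belowI (Zs i) (lexx a) ba.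
  by split=> [/h2|/h1].
Qed.

End Assembly.
Theorem theorem2p4 (d : Order.disp_t) (K : orderType d)
  (K_card : infinite_cardinal K)
  (K_I_minus : I_minus K)
  (K_diamond_or_inaccessible : diamond K \/ inaccessible K)
  (X : set (baire K)) (X_analytic : analytic X)
  (n : nat) (n_ge1 : (1 <= n)%N)
  (R : set (power n (set_type X))) (R_Fsigma : kappa_Fsigma K R) :
  (forall Y : set (set_type X), independent R Y -> Y #<= [set: K]) \/
  (exists Y : set (set_type X), independent R Y /\ perfect (set_val @` Y)).
Proof.
have [small|] := pselect (forall Y : set (set_type X), independent R Y -> Y #<= [set: K]).
  by left.
rewrite -existsNE => -[Y0 /not_implyP[Y0ind Y0big]]; right.
have [Kreg Kguess Kcode nat_ub] := guessing_hypotheses K_card K_diamond_or_inaccessible.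
have [e [S [I [succS [[idI compI _ npI] [D0 D0dense D0closed]]]]]] := K_I_minus.
have [D [Dex Dpos Ddense Dsingle Dclosed]] :=
  I_minus_conditions succS idI compI npI D0dense D0closed.
have [I0 _ I_sub I_setU] := idI.
have [g ginj] := card_gt_succ succS Y0big.
pose w (p : S) : X := \val (g p).
pose y (p : S) : baire K := \val (w p).
have winj : injective w by move=> p q /val_inj /ginj.
have yinj : injective y by move=> p q /val_inj /winj.
have [C [f [Ccl fcont XE]]] := X_analytic.
have [x xP] : {x : S -> baire K & forall p, C (x p) /\ f (x p) = y p}.
  apply: (@choice _ _ (fun p z => C z /\ f z = y p)) => p.
  have : X (y p) by exact: set_mem (valP (w p)).
  by rewrite XE => -[z Cz fz]; exists z.
have [code codeP] := point_code K_card x y Kreg Kcode.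
have [Rj [Rjcl RE]] := closed_enumeration R_Fsigma.
have [G [Gsmall Gguess]] := tuple_guessing K_card n Kguess Kreg Kcode nat_ub.
(* Speaking of all tuples near points of the conditions, and not of those points alone, lets
   avoidance reach the limit branches. *)
pose avoids (j : K) (B : 'I_n -> set S) := exists a, forall z : 'I_n -> X,
  (forall i, exists2 p, B i p & agree (y p) (\val (z i)) a) -> ~ Rj j z.
have I_bigcup := complete_bigcup succS compI.
have Dne B : D B -> B !=set0 by move=> /Dpos; exact: pos_nonempty I0 I_sub _.
have cond B : ~ I B -> ~ I (condensation I x y B).
  exact: (condensation_pos I0 I_sub I_setU I_bigcup codeP).
have [F FP] : exists F, forall a, stage D x y avoids G a F (F a).
  apply: (tower_exists K_card) => //.
  - exact: (D_split K_card I0 I_sub I_setU I_bigcup Dpos Ddense Dsingle yinj codeP).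
  - exact: (D_decide I0 I_sub I_setU I_bigcup Dpos Ddense codeP).
  - move=> j B B' BB' [a aP]; exists a => z h; apply: aP => i.
    by have [p /BB' Bp zp] := h i; exists p.
  - move=> j B DB Bdis.
    (* Disjointness makes these condensation points distinct, so independence of [Y0] keeps the
       tuple out of the closed part, and conditions near them stay off it. *)
    have [pt ptP] : {pt : 'I_n -> S & forall i, condensation I x y (B i) (pt i)}.
      apply: (@choice _ _ (fun i p => condensation I x y (B i) p)) => i.
      exact: pos_nonempty I0 I_sub _ (cond _ (Dpos _ (DB i))).
    have ptinj : injective pt.
      move=> i i' ii'; apply: contrapT => ne.
      have : (B i `&` B i') (pt i).
        by split; [exact: (ptP i).1|rewrite ii'; exact: (ptP i').1].
      by rewrite Bdis.
    have nR : ~ Rj j (fun i => w (pt i)).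
      move=> h; apply: (Y0ind (fun i => w (pt i))).
      + by move=> i i' /winj /ptinj.
      + by move=> i; exact: set_mem (valP (g (pt i))).
      + by rewrite RE; exists j.
    have [a aP] := closed_power K_card (Rjcl j) nR.
    have [B' B'P] : {B' : 'I_n -> set S & forall i,
        [/\ D (B' i), B' i `<=` B i & B' i `<=` nearby x y (pt i) a]}.
      apply: (@choice _ _ (fun i (A : set S) => [/\ D A, A `<=` B i & A `<=` nearby x y (pt i) a])) => i.
      exact: (D_near Ddense a (DB i) (ptP i)).
    exists B'; split=> [i|i|]; [by have [] := B'P i|by have [] := B'P i|].
    exists a => z h; apply: aP => i; have [p B'p pz] := h i.
    have [_ _ /(_ _ B'p) [_ h']] := B'P i.
    exact: agree_trans h' pz.
have [xZ [yZ limP]] := tower_limit K_card FP Dne.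
have yX Z : X (yZ Z).
  rewrite XE; have [h1 h2] := tower_image K_card FP Dne limP Z Ccl fcont
    (fun p => (xP p).1) (fun p => (xP p).2).
  by exists (xZ Z).
exists [set z : X | exists Z, \val z = yZ Z]; split; last first.
  rewrite (_ : _ @` _ = range (yZ : set K -> baire K)).
    exact: (tower_perfect K_card Kreg FP Dne limP).
  apply/seteqP; split=> [_ [z [Z zZ] <-]|_ [Z _ <-]]; first by exists Z.
  by exists (SigSub (mem_set (yX Z))) => //; exists Z.
move=> z zinj zY.
have [Zs ZsP] : {Zs : 'I_n -> set K & forall i, \val (z i) = yZ (Zs i)}.
  exact: (@choice _ _ (fun i Z => \val (z i) = yZ Z)).
have Zsinj : injective Zs.
  by move=> i i' ii'; apply: zinj; apply: val_inj; rewrite !ZsP ii'.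
rewrite RE => -[j _].
have [a [b bP]] := tower_avoids K_card Gguess FP j Zsinj.
(* Stage [c] lies beyond [a], so its points belong to the avoiding conditions, and beyond [b], so
   they agree with the branch far enough. *)
apply: bP => i; have [c ac bc] := cardinal_ub2 K_card a b.
have [p Zp] := tower_nonempty FP Dne c (Zs i).
exists p; first exact: (tower_decr FP (ltW ac) Zp).
by rewrite ZsP; apply: agree_le (limP _ _ _ Zp).2; exact: ltW.
Qed.
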